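(* For all integers $2\leq m\leq s$, there is $n_0\geq s$ such that every fissile $m$-digraph $H$ on $n\geq n_0$ vertices, with $n$ divisible by $m$, that $s$-robustly satisfies $\mathsf{Spa}\cap\mathsf{Div}\cap\mathsf{Cov}$ has a perfect matching.
   Context: An $m$-digraph $H$ consists of a finite vertex set $V(H)$ and an edge set $E(H)\subseteq V(H)^m$; edges are $m$-tuples and may contain repeated vertices. We write $e\in H$ for $e\in E(H)$. For a tuple $e$, $\mathrm{m}(v,e)=|\{i: e(i)=v\}|$ is the multiplicity of $v$ in $e$. A tuple is injective if it has no repeated entries. For $S\subseteq V(H)$, $H[S]$ is the $m$-digraph on $S$ with all edges of $H$ having all entries in $S$. A matching in $H$ is a set of injective edges such that no vertex is covered twice; it is perfect if every vertex of $H$ is covered. Properties: $\mathsf{Spa}$ (resp. $\mathsf{Div}$) is the set of digraphs $H$ admitting $w\colon E(H)\to[0,1]$ (resp. $w\colon E(H)\to\mathbb{Z}$) with $\sum_{e\in H}w(e)\,\mathrm{m}(v,e)=1$ for every $v\in V(H)$. $\mathsf{Cov}$ is the set of digraphs $H$ such that for every $v\in V(H)$ there is an edge $e\in H$ with $\mathrm{m}(v,e)=1$. Fissility: Let $R$ be an $m$-digraph and $\mathcal{V}=\{V_x\}_{x\in V(R)}$ a family of pairwise disjoint non-empty sets. For $f\in R$, an $m$-tuple $e\in(\bigcup\mathcal{V})^m$ is $f$-preserving if $e(i)\in V_{f(i)}$ for all $1\leq i\leq m$, and strictly $f$-preserving if in addition $e(i)=e(j)$ whenever $f(i)=f(j)$.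 The blow-up $R(\mathcal{V})$ is the $m$-digraph on $\bigcup\mathcal{V}$ containing, for every $f\in R$, all strictly $f$-preserving $m$-tuples as edges. An edge $f\in R$ is ample if $|V_{f(i)}|\geq \mathrm{m}(f(i),f)$ for each $1\leq i\leq m$. An $m$-digraph $H$ is fissile if for every blow-up $R(\mathcal{V})\subseteq H$ and every ample $f\in R$ there is an $f$-preserving injective edge in $H$. Robustness: For an $m$-digraph $H$ and a family $\mathsf{P}$ of $m$-digraphs, the property graph $P^{(s)}(H;\mathsf{P})$ is the $s$-uniform hypergraph on $V(H)$ whose edges are the $s$-sets $S\subseteq V(H)$ with $H[S]\in\mathsf{P}$. An $n$-vertex $m$-digraph $H$ $s$-robustly satisfies $\mathsf{P}$ if every vertex lies in at least $(1-1/s^2)\binom{n-1}{s-1}$ edges of $P^{(s)}(H;\mathsf{P})$. *)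

(* Defs.v *)
From mathcomp Require Import all_boot all_order all_algebra.
From mathcomp Require Import boolp classical_sets reals.

Set Implicit Arguments.
Unset Strict Implicit.
Unset Printing Implicit Defensive.

Import Order.TTheory GRing.Theory Num.Theory.

(* The vertex set is a finite set inside an ambient finType, so that induced
   digraphs, blow-ups and H all live on the same type and can be compared. *)
Record digraph (m : nat) (T : finType) := Digraph {
  verts : {set T};
  edges : {set m.-tuple T};
  edges_verts : forall e, e \in edges -> forall i, tnth e i \in verts
}.

Definition mult (m : nat) (T : finType) (v : T) (e : m.-tuple T) : nat :=
  #|[set i | tnth e i == v]|.

Definition subdigraph (m : nat) (T : finType) (G H : digraph m T) : Prop :=
  verts G \subset verts H /\ edges G \subset edges H.

Definition induced_edges (m : nat) (T : finType) (H : digraph m T)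
    (S : {set T}) : {set m.-tuple T} :=
  [set e in edges H | [forall i, tnth e i \in S]].

Lemma induced_edges_verts (m : nat) (T : finType) (H : digraph m T)
    (S : {set T}) (e : m.-tuple T) :
  e \in induced_edges H S -> forall i, tnth e i \in S.
Proof. by rewrite inE => /andP[_ /forallP]. Qed.

(* H[S], meant for S a subset of the vertex set of H. *)
Definition induced (m : nat) (T : finType) (H : digraph m T) (S : {set T}) :
    digraph m T :=
  Digraph (@induced_edges_verts m T H S).

Definition matching (m : nat) (T : finType) (H : digraph m T)
    (M : {set m.-tuple T}) : Prop :=
  [/\ M \subset edges H,
      forall e, e \in M -> uniq e
    & forall e f v, e \in M -> f \in M -> v \in e -> v \in f -> e = f].

Definition perfect_matching (m : nat) (T : finType) (H : digraph m T)
    (M : {set m.-tuple T}) : Prop :=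
  matching H M /\ forall v, v \in verts H -> exists2 e, e \in M & v \in e.

(* Only the values of the weight w on the edges of H matter. *)
Definition Spa (R : realType) (m : nat) (T : finType) : set (digraph m T) :=
  fun H => exists w : m.-tuple T -> R,
    (forall e, e \in edges H -> 0 <= w e <= 1)%R /\
    (forall v, v \in verts H ->
       \sum_(e in edges H) w e * (mult v e)%:R = 1)%R.

Definition Div (m : nat) (T : finType) : set (digraph m T) :=
  fun H => exists w : m.-tuple T -> int,
    forall v, v \in verts H ->
      (\sum_(e in edges H) w e * (mult v e)%:Z = 1)%R.

Definition Cov (m : nat) (T : finType) : set (digraph m T) :=
  fun H => forall v, v \in verts H -> exists2 e, e \in edges H & mult v e = 1.

Arguments Spa R {m T}.
Arguments Div {m T}.
Arguments Cov {m T}.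

(* A family of sets indexed by the vertices of a digraph Q on U is a function
   on U of which only the values on verts Q are used. *)
Definition blowup_family (m : nat) (U T : finType) (Q : digraph m U)
    (V : U -> {set T}) : Prop :=
  (forall x, x \in verts Q -> V x != finset.set0) /\
  (forall x y, x \in verts Q -> y \in verts Q -> x != y ->
     [disjoint V x & V y]).

Definition preserving (m : nat) (U T : finType) (V : U -> {set T})
    (f : m.-tuple U) (e : m.-tuple T) : bool :=
  [forall i, tnth e i \in V (tnth f i)].

Definition strictly_preserving (m : nat) (U T : finType) (V : U -> {set T})
    (f : m.-tuple U) (e : m.-tuple T) : bool :=
  preserving V f e &&
  [forall i, forall j, (tnth f i == tnth f j) ==> (tnth e i == tnth e j)].

Definition blowup_verts (m : nat) (U T : finType) (Q : digraph m U)
    (V : U -> {set T}) : {set T} :=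
  (\bigcup_(x in verts Q) V x)%SET.

Definition blowup_edges (m : nat) (U T : finType) (Q : digraph m U)
    (V : U -> {set T}) : {set m.-tuple T} :=
  [set e | [exists f in edges Q, strictly_preserving V f e]].

Lemma blowup_edges_verts (m : nat) (U T : finType) (Q : digraph m U)
    (V : U -> {set T}) (e : m.-tuple T) :
  e \in blowup_edges Q V -> forall i, tnth e i \in blowup_verts Q V.
Proof.
rewrite inE => /exists_inP[f fQ /andP[/forallP eV _]] i.
apply/finset.bigcupP; exists (tnth f i); [exact: (edges_verts fQ) | exact: eV].
Qed.

Definition blowup (m : nat) (U T : finType) (Q : digraph m U)
    (V : U -> {set T}) : digraph m T :=
  Digraph (@blowup_edges_verts m U T Q V).

Definition ample (m : nat) (U T : finType) (V : U -> {set T})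
    (f : m.-tuple U) : Prop :=
  forall i, mult (tnth f i) f <= #|V (tnth f i)|.

Definition fissile (m : nat) (T : finType) (H : digraph m T) : Prop :=
  forall (U : finType) (Q : digraph m U) (V : U -> {set T}),
    blowup_family Q V -> subdigraph (blowup Q V) H ->
    forall f, f \in edges Q -> ample V f ->
    exists e, [/\ e \in edges H, preserving V f e & uniq e].

Definition property_graph (s m : nat) (T : finType) (H : digraph m T)
    (P : set (digraph m T)) : {set {set T}} :=
  [set S : {set T} | [&& S \subset verts H, #|S| == s & `[< P (induced H S) >]]].

Definition robustly_satisfies (s m : nat) (T : finType) (H : digraph m T)
    (P : set (digraph m T)) : Prop :=
  forall v, v \in verts H ->
    ((1 - 1 / s%:R ^+ 2) * 'C(#|verts H|.-1, s.-1)%:R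
       <= #|[set S in property_graph s H P | v \in S]|%:R :> rat)%R.

(* Main.v *)
(* A frame is a partition of the vertices of H into m-tuples, called groups;
   take one in which as many groups as possible are edges of H, and suppose
   that some group x is not an edge. By a union bound, a positive proportion of
   the (s-1)-tuples of groups extend a given vertex a: suitable cyclic
   transversals of them, one vertex per group, complete a to m good s-sets, and
   one of these transversals also completes a pivot z. Iterating, a positive
   proportion of the tuples (h_j) of groups form a tree of three levels of
   extensions rooted at z and at the vertices of x. By pigeonhole and Erdos'
   theorem on dense s-partite relations, some such tree can be blown up:
   every group is replaced by b groups, and every choice gives the same digraph
   on J * [m] + [m].

   In that digraph, call a vector v absorbable if c - v is a sum of edges for
   some nonnegative c constant on groups. Spa, after clearing denominators,
   says that an extension of a makes - E a absorbable, and hence also E a, since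
   the group of a is absorbable. So edges are absorbable with both signs, and
   Div makes a - z, hence every vector of total 0 mod m on the first level,
   absorbable. Cov provides for each vertex of x an edge containing it once; the
   rest of these edges is absorbable, so x together with c_j groups from the
   j-th cluster splits into edges. Fissility turns this into disjoint injective
   edges of H, and more groups of the resulting frame are edges of H. *)

Require Import Defs.
From mathcomp Require Import all_boot all_order all_algebra.
From mathcomp Require Import boolp classical_sets reals.
From mathcomp Require Import zify lra ring.

Set Implicit Arguments.
Unset Strict Implicit.
Unset Printing Implicit Defensive.

Import Order.TTheory GRing.Theory Num.Theory.

(** * Boxes in dense relations *)

Lemma ffact_pred_leq (n k : nat) : n.-1 ^_ k <= n ^ k.
Proof.
elim: k => // k IHk; rewrite ffactnSr expnSr leq_mul //.
exact: leq_trans (leq_subr _ _) (leq_pred n).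
Qed.

(** Among the [n ^ k] tuples over [n] points, those that repeat an entry or hit one fixed point make
    up a proportion of at most [k * k / n]; the extra factor [n] avoids the division. *)
Lemma expn_ffact_defect (n k : nat) :
  0 < n -> n ^ k.+1 <= n * n.-1 ^_ k + k * k * n ^ k.
Proof.
move=> n_gt0; elim: k => [|k IHk]; first by rewrite expn1 muln1 leq_addr.
have ffle := ffact_pred_leq n k.
have step : n * n.-1 ^_ k <= n.-1 ^_ k.+1 + k.+1 * n ^ k.
  rewrite ffactnSr; have : (n.-1 - k) + k.+1 >= n by lia.
  move: (n.-1 - k) => d; nia.
rewrite expnS (leq_trans (leq_mul (leqnn n) IHk)) //.
rewrite mulnDr (leq_trans (leq_add (leq_mul (leqnn n) step) (leqnn _))) //.
rewrite (expnS n k); move: (n.-1 ^_ k.+1) (n ^ k) => A B; nia.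
Qed.

Lemma expn_ffact_close (k c : nat) :
  exists n0, forall n, n0 <= n -> c * (n ^ k - n.-1 ^_ k) <= n ^ k.
Proof.
exists (c * (k * k)).+1 => n n_ge; have n_gt0 : 0 < n by lia.
have := expn_ffact_defect k n_gt0; rewrite expnS => defect.
rewrite -(leq_pmul2l n_gt0).
move: (n ^ k) (n.-1 ^_ k) defect => A B defect.
have : n * (A - B) <= k * k * A by nia.
nia.
Qed.

Definition upd (A J : finType) (g : {ffun J -> A}) (j : J) (a : A) :
  {ffun J -> A} := [ffun i => if i == j then a else g i].

(** Exchanging [a] with the value [g j] that it overwrites is an involution on pairs, which carries
    the condition on [upd g j a] to the same condition on [g]. *)
Lemma sum_slice (A J : finType) (R : {set {ffun J -> A}}) (j : J) :
  \sum_g #|[set a | upd g j a \in R]| = #|A| * #|R|.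
Proof.
under eq_bigr do rewrite -sum1dep_card big_mkcond.
rewrite pair_big /=.
pose h (p : {ffun J -> A} * A) := (upd p.1 j p.2, p.1 j).
have hK : involutive h.
  move=> [g a]; rewrite /h /= ffunE eqxx; congr pair.
  by apply/ffunP => i; rewrite !ffunE; case: eqP => [->|].
rewrite (reindex_inj (inv_inj hK)) /=.
under eq_bigr => p _.
  have -> : upd (upd p.1 j p.2) j (p.1 j) = p.1 := congr1 fst (hK p).
  over.
rewrite -(pair_big xpredT xpredT (fun g (_ : A) => if g \in R then 1 else 0)) /=.
under eq_bigr do rewrite sum_nat_const.
by rewrite -big_distrr /= -big_mkcond sum1_card.
Qed.

(** One coordinate of Erdos' theorem. [W] grows one value at a time, and averaging over the values
    outside [W] costs a factor [4 * c] for each. *)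
Lemma dense_slice (A J : finType) (R : {set {ffun J -> A}}) (j : J) (b c : nat) :
  0 < #|A| -> 4 * c * b <= #|A| -> #|{ffun J -> A}| <= c * #|R| ->
  exists2 W : {set A}, #|W| = b &
    #|{ffun J -> A}| <= 2 * c * (4 * c) ^ b *
      #|[set g | [forall a in W, upd g j a \in R]]|.
Proof.
move=> A_gt0 leA leR; set N := #|A| in A_gt0 leA.
set K := #|{ffun J -> A}| in leR *.
pose deg g := #|[set a | upd g j a \in R]|.
(* Heavy means that at least a proportion [1 / (2 * c)] of the values at [j] is allowed. The average
   proportion is at least [1 / c], so heavy [g] themselves have density at least [1 / (2 * c)]. *)
pose heavy := [set g | N <= 2 * c * deg g].
have K_heavy : K <= 2 * c * #|heavy|.
  have := sum_slice R j; rewrite (bigID (mem heavy)) /= -/N => sumR.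
  have le1 : \sum_(g in heavy) deg g <= N * #|heavy|.
    by rewrite mulnC -sum_nat_const leq_sum // => g _; exact: max_card.
  have le2 : 2 * c * (\sum_(g | g \notin heavy) deg g) <= N * K.
    rewrite big_distrr /= (leq_trans (n := \sum_(g | g \notin heavy) N)) //.
      by apply: leq_sum => g; rewrite inE -ltnNge => /ltnW.
    by rewrite sum_nat_const mulnC leq_mul2l max_card orbT.
  rewrite -(leq_pmul2l A_gt0) -/N.
  move: le1 le2 sumR; set s1 := (X in X <= _); set s2 := \sum_(_ | _) _.
  move=> le1 le2 sumR.
  have le3 : 2 * (N * K) <= 2 * c * s1 + 2 * c * s2.
    rewrite -mulnDr sumR -!mulnA leq_mul2l /= [c * _]mulnCA leq_mul2l leR.
    by rewrite orbT.
  have le4 : 2 * c * s1 <= 2 * c * (N * #|heavy|) by rewrite leq_mul2l le1 orbT.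
  clear sumR le1; move: (N) (K) s1 s2 (#|heavy|) le2 le3 le4 => n k' u v h.
  nia.
suff [W sW HW] : exists2 W : {set A}, #|W| = b &
    K <= 2 * c * (4 * c) ^ b *
      #|[set g in heavy | [forall a in W, upd g j a \in R]]|.
  exists W => //; apply: leq_trans HW _; rewrite leq_mul2l; apply/orP; right.
  by apply: subset_leq_card; apply/fintype.subsetP => g; rewrite !inE => /andP[].
elim: b leA => [|b IHb] leA.
  exists finset.set0; first by rewrite cards0.
  rewrite expn0 muln1 (leq_trans K_heavy) // leq_mul2l subset_leq_card ?orbT //.
  apply/fintype.subsetP => g gh; rewrite inE gh /=.
  by apply/forallP => a; rewrite inE.
have [|W sW HW] := IHb; first by apply: leq_trans leA; rewrite leq_mul2l leqnSn orbT.
set G := [set g in heavy | _] in HW.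
(* The values already in [W] are at most half of those that a heavy [g] allows, so a proportion
   [1 / (4 * c)] of all values remains outside [W]. This is why the induction keeps [g] heavy. *)
have sumG : #|G| * N <= 4 * c * \sum_(a in ~: W) #|[set g in G | upd g j a \in R]|.
  have -> : \sum_(a in ~: W) #|[set g in G | upd g j a \in R]| =
     \sum_(g in G) #|[set a in ~: W | upd g j a \in R]|.
    under eq_bigr do rewrite -sum1dep_card big_mkcondr /=.
    rewrite exchange_big /=; apply: eq_bigr => g _.
    by rewrite -big_mkcondr sum1dep_card.
  rewrite big_distrr /= -sum_nat_const; apply: leq_sum => g.
  rewrite inE => /andP[]; rewrite inE => gh _.
  have : deg g <= #|[set a in ~: W | upd g j a \in R]| + b.
    rewrite -sW /deg -(cardsID W [set a | _]) addnC leq_add //.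
      by apply: subset_leq_card; apply/fintype.subsetP=> a; rewrite !inE andbC.
    by apply: subset_leq_card; apply/fintype.subsetP=> a; rewrite !inE => /andP[].
  move=> /(leq_mul (leqnn (2 * c))); move: gh leA; rewrite -/N.
  move: (N) (deg g) #|[set a in ~: W | _]| => n d x; nia.
have /existsP[a /andP[aW Ga]] : [exists a, (a \notin W) &&
    (#|G| <= 4 * c * #|[set g in G | upd g j a \in R]|)].
  apply: contraLR sumG; rewrite negb_exists => /forallP sm.
  have G_gt0 : 0 < #|G|.
    rewrite lt0n; apply/eqP => G0; move: HW; rewrite G0 muln0 leqn0.
    apply/negP; rewrite -lt0n; apply/card_gt0P.
    by exists [ffun=> enum_val (Ordinal A_gt0)].
  rewrite -ltnNge big_distrr /=.
  have le1 : \sum_(a in ~: W) 4 * c * #|[set g in G | upd g j a \in R]| +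
      #|~: W| <= #|~: W| * #|G|.
    rewrite -sum_nat_const -[X in _ + X]sum1_card -big_split /=; apply: leq_sum => a.
    rewrite inE => aW; have := sm a.
    by rewrite aW /= -ltnNge addn1.
  have le2 : #|~: W| * #|G| <= #|G| * N by rewrite mulnC leq_mul2l max_card orbT.
  have GN_gt0 : 0 < #|G| * N by rewrite muln_gt0 G_gt0.
  move: le1 le2 GN_gt0; move: (\sum_(_ in _) _) (#|~: W|) (#|G| * N) #|G| => x y z t.
  by case: (posnP y) => [->|]; nia.
exists (a |: W); first by rewrite cardsU1 aW sW.
apply: leq_trans HW _.
apply: (@leq_trans (2 * c * (4 * c) ^ b *
  (4 * c * #|[set g in G | upd g j a \in R]|))).
  by rewrite leq_mul2l Ga orbT.
rewrite expnS [_ * (_ * #|_|)]mulnA -[2 * c * _ * _]mulnA.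
rewrite [(4 * c) ^ b * _]mulnC.
rewrite leq_mul2l subset_leq_card ?orbT //; apply/fintype.subsetP => g.
rewrite !inE => /andP[/andP[-> /forall_inP gW] ga] /=.
by apply/forall_inP => a'; rewrite !inE => /predU1P[->//|/gW].
Qed.

(** The base points [g] around which the coordinates in [js] may vary freely within [W] again form a
    dense relation, so [dense_slice] applies to it at the next coordinate. *)
Lemma dense_box_seq (l b c : nat) : exists N0 c' : nat,
  forall (A J : finType) (R : {set {ffun J -> A}}) (js : seq J),
    size js = l -> uniq js -> N0 <= #|A| -> #|{ffun J -> A}| <= c * #|R| ->
  exists2 W : J -> {set A}, forall j, j \in js -> #|W j| = b &
    #|{ffun J -> A}| <= c' * #|[set g : {ffun J -> A} | [forall g' : {ffun J -> A},
      [forall i, if i \in js then g' i \in W i else g' i == g i]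
        ==> (g' \in R)]]|.
Proof.
elim: l => [|l [N1 [c1 IHl]]].
  exists 0, c => A J R js /eqP; rewrite size_eq0 => /eqP-> _ _ leR.
  exists (fun=> finset.set0) => //; apply: leq_trans leR _.
  rewrite leq_mul2l subset_leq_card ?orbT //; apply/fintype.subsetP => g gR.
  rewrite inE; apply/forallP => g'; apply/implyP => /forallP g'g.
  suff -> : g' = g by [].
  by apply/ffunP => i; apply/eqP; have := g'g i.
exists (N1 + 4 * c1 * b).+1, (2 * c1 * (4 * c1) ^ b) => A J R [//|j js].
case=> sjs /= /andP[jjs ujs] leA leR.
have [|W sW] := IHl A J R js sjs ujs _ leR.
  exact: leq_trans (leq_addr _ _) (ltnW leA).
set R' := [set g | _] => leR'.
have [||Wj sWj leW] := @dense_slice A J R' j b c1 _ _ leR'.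
- exact: leq_trans leA.
- exact: leq_trans (leq_addl _ _) (ltnW leA).
exists (fun i => if i == j then Wj else W i).
  move=> i; rewrite inE; case: eqP => [//|_] /=; exact: sW.
apply: leq_trans leW _; rewrite leq_mul2l subset_leq_card ?orbT //.
apply/fintype.subsetP => g; rewrite !inE => /forall_inP gW.
apply/forallP => g'; apply/implyP => /forallP g'g.
have g'j : g' j \in Wj by have := g'g j; rewrite inE eqxx.
have := gW _ g'j; rewrite inE => /forallP/(_ g')/implyP; apply.
apply/forallP => i; have := g'g i; rewrite inE ffunE.
case: (eqVneq i j) => [-> _|//] /=; by rewrite (negPf jjs).
Qed.

Lemma dense_box (k b c : nat) : exists N0 : nat,
  forall (A J : finType) (R : {set {ffun J -> A}}),
    #|J| = k -> N0 <= #|A| -> #|{ffun J -> A}| <= c * #|R| ->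
  exists2 W : J -> {set A}, forall j, #|W j| = b &
    forall g : {ffun J -> A}, (forall j, g j \in W j) -> g \in R.
Proof.
have [N0 [c' box]] := dense_box_seq k b c.
exists N0.+1 => A J R cJ leA leR.
have sJ : size (enum J) = k by rewrite -cardE.
have [|W sW] := box A J R (enum J) sJ (enum_uniq _) _ leR; first exact: ltnW.
set R' := [set g | _] => leR'; exists W => [j|g gW].
  by rewrite sW ?mem_enum.
have A_gt0 : 0 < #|A| by exact: leq_trans leA.
have : 0 < #|R'|.
  rewrite lt0n; apply/eqP => R0; move: leR'; rewrite R0 muln0 leqn0.
  by apply/negP; rewrite -lt0n; apply/card_gt0P; exists [ffun=> enum_val (Ordinal A_gt0)].
case/card_gt0P => g0; rewrite inE => /forallP/(_ g)/implyP; apply.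
by apply/forallP => i; rewrite mem_enum; exact: gW.
Qed.

(** * Simultaneous approximation *)

(** Dirichlet's pigeonhole argument: two multiples [l < k] of [w] have all their fractional parts in
    the same cell of side [1 / N], and [D = k - l]. Nonnegativity of [w] makes the rounded values
    natural numbers. *)
Lemma simultaneous_approx (R : realType) (I : finType) (w : I -> R) (N : nat) :
  0 < N -> (forall i, 0 <= w i)%R ->
  exists (D : nat) (c : I -> nat), 0 < D /\
    forall i, (`|N%:R * (D%:R * w i - (c i)%:R)| < 1)%R.
Proof.
move=> N_gt0 w_ge0.
pose t k i := Num.truncn (N%:R * (k%:R * w i))%R.
pose box (k : 'I_(#|{ffun I -> 'I_N}|.+1)) : {ffun I -> 'I_N} :=
  [ffun i => Ordinal (ltn_pmod (t k i) N_gt0)].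
have [k [l [lt_lk eq_box]]] : exists k l : 'I_(#|{ffun I -> 'I_N}|.+1),
    (l < k)%N /\ box k = box l.
  have /injectiveP : ~~ injectiveb box.
    apply/negP => /injectiveP /leq_card; by rewrite card_ord ltnn.
  move=> ninj; apply: contrapT => nex; apply: ninj => k l eq_kl.
  apply/eqP; rewrite -val_eqE; case: ltngtP => // lt_kl; case: nex.
    by exists l, k.
  by exists k, l.
exists (k - l), (fun i => t k i %/ N - t l i %/ N).
split=> [|i]; first by rewrite subn_gt0.
have : (t k i %% N = t l i %% N)%N.
  by have /ffunP/(_ i) := eq_box; rewrite !ffunE => /(congr1 val).
move=> eq_mod.
have t_itv j : ((t j i)%:R <= N%:R * (j%:R * w i) < (t j i)%:R + 1)%R.
  have : (0 <= N%:R * (j%:R * w i))%R by rewrite !mulr_ge0.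
  by move=> /truncn_itv; rewrite natr1.
have le_t : (t l i <= t k i)%N.
  by rewrite le_truncn // ler_wpM2l // ler_wpM2r // ler_nat ltnW.
have le_tN := leq_div2r N le_t.
rewrite natrB 1?ltnW // natrB //.
move: (t_itv k) (t_itv l).
rewrite {1 2}(divn_eq (t k i) N) {1 2}(divn_eq (t l i) N) eq_mod.
rewrite !natrD !natrM.
move: (w i) (t k i %/ N)%:R%R (t l i %/ N)%:R%R (t l i %% N)%:R%R => x a b r.
move: (nat_of_ord k)%:R%R (nat_of_ord l)%:R%R (N%:R)%R => k' l' N'.
move=> /andP[h1 h2] /andP[h3 h4]; rewrite ltr_norml.
rewrite !mulrBr !mulrBl !mulrBr.
rewrite (mulrC a) in h1 h2 *; rewrite (mulrC b) in h3 h4 *.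
apply/andP; split; lra.
Qed.

(** A multiple of [w] is rounded. As [N] exceeds every row sum of [A], the error in each equation is
    below 1; both sides are integers, so the error vanishes. Real weights are thus cleared of
    denominators without passing through rational ones. *)
Lemma nonneg_integral_solution (R : realType) (I V : finType) (A : V -> I -> nat)
    (b : V -> nat) (w : I -> R) :
  (forall i, 0 <= w i)%R ->
  (forall v, \sum_i w i * (A v i)%:R = (b v)%:R)%R ->
  exists (D : nat) (c : I -> nat), 0 < D /\
    forall v, \sum_i c i * A v i = D * b v.
Proof.
move=> w_ge0 Aw; pose N := (\sum_v \sum_i A v i).+1.
have [D [c [D_gt0 Dc]]] := @simultaneous_approx R I w N isT w_ge0.
exists D, c; split=> // v.
pose S := (\sum_i c i * A v i)%N.
have eqS : (N%:R * (D * b v)%:R - N%:R * S%:R = \sum_i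
    (N%:R * (D%:R * w i - (c i)%:R)) * (A v i)%:R :> R)%R.
  rewrite natrM -Aw natr_sum !mulr_sumr -sumrB; apply: eq_bigr => i _.
  by rewrite natrM; ring.
have : (`|N%:R * (D * b v)%:R - N%:R * S%:R| < N%:R :> R)%R.
  rewrite eqS (le_lt_trans (ler_norm_sum _ _ _)) //.
  apply: (@le_lt_trans _ _ (\sum_i (A v i)%:R)%R).
    apply: ler_sum => i _; rewrite normrM [X in (_ * X <= _)%R]ger0_norm //.
    by rewrite ler_piMl // ltW.
  rewrite -natr_sum ltr_nat ltnS (bigD1 v) //= leq_addr //.
rewrite -mulrBr normrM ger0_norm // gtr_pMr ?ltr0n //.
rewrite -[(D * b v)%:R%R]/((D * b v)%:Z%:~R)%R -[S%:R%R]/(S%:Z%:~R)%R -intrB.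
rewrite -intr_norm ltrz1 => lt1; apply/eqP; rewrite -/S.
lia.
Qed.

(** * Good sets and their edge vectors *)

Section Semigroup.
Local Open Scope ring_scope.

Variables (m : nat) (U : finType).

Definition pt (a : U) : {ffun U -> int} := [ffun u => (u == a)%:Z].

Definition mass (f : m.-tuple U) : {ffun U -> int} := [ffun u => (mult u f)%:Z].

Lemma mult_notin (f : m.-tuple U) (u : U) :
  (forall i, tnth f i != u) -> mult u f = 0%N.
Proof.
move=> fu; apply/eqP; rewrite cards_eq0; apply/eqP/setP => i.
by rewrite !inE (negPf (fu i)).
Qed.

Definition indic (S : {set U}) : {ffun U -> int} := [ffun u => (u \in S)%:Z].

Lemma mass_sum (f : m.-tuple U) : mass f = \sum_i pt (tnth f i).
Proof.
apply/ffunP => u; rewrite sum_ffunE ffunE /mult -sum1dep_card big_mkcond.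
rewrite -natz natr_sum; apply: eq_bigr => i _.
by rewrite ffunE eq_sym; case: eqP.
Qed.

(** [Spa], [Div] and [Cov] in the form used for absorption, with one edge set [EQ] common to all
    [S]. The real weight of [Spa] has become a multiset of edges covering [S] exactly [D] times; as
    masses are nonnegative, these edges lie inside [S]. *)
Record goodset (EQ : {set m.-tuple U}) (S : {set U}) : Prop := GoodSet {
  goodset_spa : exists (D : nat) (es : seq (m.-tuple U)),
    [/\ (0 < D)%N, {subset es <= EQ} & \sum_(f <- es) mass f = indic S *+ D];
  goodset_div : exists w : m.-tuple U -> int,
    indic S = \sum_(f in EQ | [forall i, tnth f i \in S]) mass f *~ w f;
  goodset_cov : forall u, u \in S -> exists f,
    [/\ f \in EQ, forall i, tnth f i \in S & mult u f = 1%N]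
}.

Lemma sum_nseq_flatten (I : finType) (V : nmodType) (F : I -> V) (c : I -> nat) :
  \sum_(f <- flatten [seq nseq (c f) f | f <- enum I]) F f = \sum_f F f *+ c f.
Proof.
rewrite big_flatten big_map big_enum /=; apply: eq_bigr => f _.
by rewrite big_nseq iter_addr_0.
Qed.

End Semigroup.

Section Transport.
Local Open Scope ring_scope.

Variables (R : realType) (m : nat) (U T : finType) (phi : U -> T).
Variables (H : digraph m T) (S : {set U}).
Hypothesis phi_inj : injective phi.

Let ES : {set m.-tuple U} :=
  [set f | [forall i, tnth f i \in S] & map_tuple phi f \in edges H].

Lemma mult_map (f : m.-tuple U) (u : U) : mult (phi u) (map_tuple phi f) = mult u f.
Proof.
by apply: eq_card => i; rewrite !inE tnth_map (inj_eq phi_inj).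
Qed.

Lemma map_tuple_inj : injective (map_tuple (n := m) phi).
Proof. by move=> f g [/(inj_map phi_inj) fg]; apply: val_inj. Qed.

Lemma edges_induced_imset : edges (induced H (phi @: S)) = map_tuple phi @: ES.
Proof.
apply/setP => e; rewrite inE; apply/andP/imsetP.
  move=> [eH /forallP eS].
  have /fin_all_exists2[g gS eg] i : exists2 u, u \in S & tnth e i = phi u.
    by have /imsetP[u] := eS i; exists u.
  have e_map : e = map_tuple phi (mktuple g).
    by apply: eq_from_tnth => i; rewrite eg tnth_map tnth_mktuple.
  exists (mktuple g) => //; rewrite inE -e_map eH andbT.
  by apply/forallP => i; rewrite tnth_mktuple.
move=> [f]; rewrite inE => /andP[/forallP fS fH] ->; split=> //.
by apply/forallP => i; rewrite tnth_map imset_f.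
Qed.

(** The edges of [H] inside [phi @: S] are the images of [ES], so all three weights pull back along
    [phi]; [nonneg_integral_solution] makes the first one integral. *)
Lemma goodset_transport (EQ : {set m.-tuple U}) : ES \subset EQ ->
  (Spa R `&` Div `&` Cov)%classic (induced H (phi @: S)) -> goodset EQ S.
Proof.
move=> /fintype.subsetP ES_EQ [[spaS divS] covS]; split.
- have [w [w01 sw]] := spaS.
  (* Weights and multiplicities vanish outside [ES], so that the linear system can be indexed by all
     tuples. *)
  pose w' (f : m.-tuple U) := if f \in ES then w (map_tuple phi f) else 0.
  pose A (u : U) (f : m.-tuple U) := if f \in ES then mult u f else 0%N.
  have [f|u|D [c [D_gt0 Dc]]] :=
      @nonneg_integral_solution R _ _ A (fun u => (u \in S) : nat) w' _ _.
  + rewrite /w'; case: ifP => // fES.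
    have : map_tuple phi f \in edges (induced H (phi @: S)).
      by rewrite edges_induced_imset imset_f.
    by case/w01/andP.
  + have [uS|uS] := boolP (u \in S).
      have := sw (phi u) (imset_f phi uS).
      rewrite edges_induced_imset big_imset /=; last by move=> f g _ _ /map_tuple_inj.
      move=> sw1; apply: etrans sw1.
      rewrite big_mkcond [RHS]big_mkcond /=; apply: eq_bigr => f _.
      by rewrite /w' /A; case: ifP => _; rewrite ?mul0r // mult_map.
    apply: big1 => f _; rewrite /w' /A; case: ifP => [|_]; last by rewrite mul0r.
    rewrite inE => /andP[/forallP fS _].
    rewrite mult_notin ?mulr0 // => i.
    by apply: contraNneq uS => <-.
  + pose c' f := if f \in ES then c f else 0%N.
    exists D, (flatten [seq nseq (c' f) f | f <- enum {: m.-tuple U}]); split=> //.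
      move=> f /flatten_mapP[g _]; rewrite mem_nseq => /andP[c_gt0 /eqP->].
      by move: c_gt0; rewrite /c'; case: ifP => // /ES_EQ.
    rewrite sum_nseq_flatten; apply/ffunP => u; rewrite sum_ffunE ffunMnE ffunE.
    have -> : (u \in S)%:Z *+ D = (D * (u \in S))%:R :> int.
      by rewrite natrM mulr_natl natz.
    rewrite -Dc natr_sum; apply: eq_bigr => f _.
    rewrite ffunMnE ffunE /A /c'; case: ifP => _; last by rewrite muln0.
    by rewrite natrM mulr_natl natz.
- have [w sw] := divS.
  exists (fun f => if f \in ES then w (map_tuple phi f) else 0).
  have -> : \sum_(f in EQ | [forall i, tnth f i \in S])
      mass f *~ (if f \in ES then w (map_tuple phi f) else 0) =
      \sum_(f in ES) mass f *~ w (map_tuple phi f).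
    rewrite big_mkcond [RHS]big_mkcond /=; apply: eq_bigr => f _.
    case: ifP => [|/negbT]; first by case: ifP.
    case: ifP => // fES; rewrite ES_EQ //=; move: fES; rewrite inE.
    by case/andP=> ->.
  apply/ffunP => u; rewrite sum_ffunE ffunE.
  have [uS|uS] := boolP (u \in S).
    have := sw (phi u) (imset_f phi uS).
    rewrite edges_induced_imset big_imset /=; last by move=> f g _ _ /map_tuple_inj.
    move=> sw1; apply/esym; apply: etrans sw1; apply: eq_bigr => f _.
    by rewrite ffunMzE ffunE mult_map mulrzz mulrC.
  rewrite big1 // => f; rewrite inE => /andP[/forallP fS _].
  rewrite ffunMzE ffunE mult_notin ?mul0rz //.
  by move=> i; apply: contraNneq uS => <-.
- move=> u uS; have [e] := covS (phi u) (imset_f phi uS).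
  rewrite edges_induced_imset => /imsetP[f fES ->]; rewrite mult_map => fu.
  exists f; split=> //; first exact: ES_EQ.
  by move: fES; rewrite inE => /andP[/forallP].
Qed.
End Transport.

(** * Absorbable vectors *)

Definition shift (m : nat) (p q : 'I_m) : 'I_m :=
  Ordinal (ltn_pmod (p + q) (leq_ltn_trans (leq0n p) (ltn_ord p))).

Lemma shift_inj (m : nat) (p : 'I_m) : injective (shift p).
Proof.
move=> q r [/eqP]; rewrite eqn_modDl !modn_small // => /eqP; exact: val_inj.
Qed.

Lemma shiftC (m : nat) (p q : 'I_m) : shift p q = shift q p.
Proof. by apply: val_inj; rewrite /= addnC. Qed.

Lemma common_multiple (I : finType) (P : I -> nat -> Prop) :
  (forall i d e, 0 < e -> P i d -> P i (d * e)) ->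
  (forall i, exists2 d, 0 < d & P i d) ->
  exists2 D, 0 < D & forall i, P i D.
Proof.
move=> PM /fin_all_exists2[d d_gt0 Pd].
exists (\prod_i d i) => [|i]; first exact: prodn_gt0.
by rewrite (bigD1 i) //=; apply: PM => //; apply: prodn_gt0.
Qed.

Section Absorbable.
Local Open Scope ring_scope.

Variables (m : nat) (J : finType).
Local Notation U := (J * 'I_m + 'I_m)%type.

Definition group_vec (c : J -> nat) : {ffun U -> int} :=
  [ffun u => if u is inl (j, _) then (c j)%:Z else 0].

Variables (EQ : {set m.-tuple U}).

(* Some number of full copies of the groups, minus v, splits into edges. *)
Definition absorbable (v : {ffun U -> int}) : Prop :=
  exists (c : J -> nat) (es : seq (m.-tuple U)),
    {subset es <= EQ} /\ v + \sum_(f <- es) mass f = group_vec c.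

(** Absorbable vectors form a monoid under addition; the balanced ones are its invertible elements
    and form a group. *)
Definition balanced v : Prop := absorbable v /\ absorbable (- v).

Lemma absorbable_vec (c : J -> nat) : absorbable (group_vec c).
Proof. by exists c, [::]; split=> //; rewrite big_nil addr0. Qed.

Lemma absorbable_edges (es : seq (m.-tuple U)) : {subset es <= EQ} ->
  absorbable (- \sum_(f <- es) mass f).
Proof.
move=> esE; exists (fun=> 0%N), es; split=> //; rewrite addNr.
by apply/ffunP => -[[j p]|p]; rewrite !ffunE.
Qed.

Lemma absorbableD v w : absorbable v -> absorbable w -> absorbable (v + w).
Proof.
move=> [c [es [esE ces]]] [d [fs [fsE dfs]]].
exists (fun j => c j + d j)%N, (es ++ fs); split.
  by move=> f; rewrite mem_cat => /orP[/esE|/fsE].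
rewrite big_cat /= addrACA ces dfs; apply/ffunP => u; rewrite !ffunE.
by case: u => [[j p]|p]; rewrite ?PoszD ?addr0.
Qed.

Lemma absorbable0 : absorbable 0.
Proof. by have := @absorbable_edges [::]; rewrite big_nil oppr0; apply. Qed.

Lemma absorbableMn v n : absorbable v -> absorbable (v *+ n).
Proof.
move=> av; elim: n => [|n IHn]; first by rewrite mulr0n; exact: absorbable0.
by rewrite mulrS; apply: absorbableD.
Qed.

Lemma absorbable_sum (I : Type) (r : seq I) (P : pred I) (F : I -> {ffun U -> int}) :
  (forall i, P i -> absorbable (F i)) -> absorbable (\sum_(i <- r | P i) F i).
Proof. by move=> aF; elim/big_ind: _ => //; [exact: absorbable0|exact: absorbableD]. Qed.

Lemma balanced0 : balanced 0.
Proof. by split; rewrite ?oppr0; exact: absorbable0. Qed.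

Lemma balancedN v : balanced v -> balanced (- v).
Proof. by case=> av aNv; split; rewrite ?opprK. Qed.

Lemma balancedD v w : balanced v -> balanced w -> balanced (v + w).
Proof. by move=> [av aNv] [aw aNw]; split; rewrite ?opprD; exact: absorbableD. Qed.

Lemma balancedB v w : balanced v -> balanced w -> balanced (v - w).
Proof. by move=> bv /balancedN; exact: balancedD. Qed.

Lemma balanced_sum (I : Type) (r : seq I) (P : pred I) (F : I -> {ffun U -> int}) :
  (forall i, P i -> balanced (F i)) -> balanced (\sum_(i <- r | P i) F i).
Proof. by move=> bF; elim/big_ind: _ => //; [exact: balanced0|exact: balancedD]. Qed.

Lemma balancedMn v n : balanced v -> balanced (v *+ n).
Proof. by case=> av aNv; split; rewrite -?mulNrn; exact: absorbableMn. Qed.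

Lemma balancedMz v (z : int) : balanced v -> balanced (v *~ z).
Proof.
move=> bv; case: z => n; first by rewrite -pmulrn; exact: balancedMn.
by rewrite NegzE mulrNz -pmulrn; apply/balancedN/balancedMn.
Qed.

Variables (k : nat) (lev : J -> nat) (z : J * 'I_m).

Definition ulev (u : U) : nat := if u is inl (j, _) then lev j else 0%N.

Definition transversal_set (gr : 'I_k -> J) (sg : 'I_k -> 'I_m) (q : 'I_m) :
  {set U} := [set inl (gr i, shift (sg i) q) | i : 'I_k].

(* The common pivot [z] makes any two roots exchangeable modulo edges. *)
Definition extends (a : U) (gr : 'I_k -> J) (sg : 'I_k -> 'I_m) : Prop :=
  [/\ injective gr, forall i, lev (gr i) = (ulev a).+1,
      forall q, goodset EQ (a |: transversal_set gr sg q) &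
      exists q, goodset EQ (inl z |: transversal_set gr sg q)].

Hypothesis m_gt0 : (0 < m)%N.
Hypothesis lev_z : lev z.1 = 0%N.
Hypothesis ext : forall a, (ulev a <= 2)%N -> exists gr sg, extends a gr sg.

(** The vertices [inr p] are excluded: they have level 0 for [ulev], but [group_vec] cannot supply
    their group. *)
Definition low (l : nat) (u : U) : bool :=
  if u is inl (j, _) then (lev j <= l)%N else false.

Lemma lowW l u : low l u -> (ulev u <= l)%N.
Proof. by case: u => // -[]. Qed.

Lemma low_leq l l' u : (l <= l')%N -> low l u -> low l' u.
Proof. by move=> le; case: u => // -[j p] /= /leq_trans; apply. Qed.

Lemma low_transversal a gr sg q u :
  extends a gr sg -> u \in transversal_set gr sg q -> low (ulev a).+1 u.
Proof. by case=> _ lev_gr _ _ /imsetP[i _ ->] /=; rewrite lev_gr. Qed.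

Lemma notin_transversal a gr sg q u :
  extends a gr sg -> (ulev u <= ulev a)%N -> u \notin transversal_set gr sg q.
Proof.
case=> _ lev_gr _ _ le; apply/imsetP => -[i _ eu].
by move: le; rewrite eu /= lev_gr ltnn.
Qed.

Lemma indicU1 (a : U) (S : {set U}) : a \notin S ->
  indic (a |: S) = pt a + indic S.
Proof.
move=> aS; apply/ffunP => u; rewrite !ffunE !inE.
by case: eqVneq => [->|]; rewrite ?(negPf aS) ?addr0 ?add0r.
Qed.

(** For fixed offsets [sg], the cyclic shifts by all [q] pass through each vertex of the groups
    [gr i] exactly once. *)
Lemma sum_transversals a gr sg : extends a gr sg ->
  \sum_q indic (transversal_set gr sg q) =
  group_vec (fun j => [exists i, gr i == j]).
Proof.
case=> gr_inj _ _ _; apply/ffunP => u; rewrite sum_ffunE ffunE.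
under eq_bigr do rewrite ffunE.
case: u => [[j p]|p]; last first.
  by apply: big1 => q _; case: imsetP => [[]|].
case: existsP => [[i /eqP<-]|nex]; last first.
  apply: big1 => q _; case: imsetP => [[i _ [ej _]]|//].
  by case: nex; exists i; rewrite ej.
have {1}-> : p = shift (sg i) (invF (@shift_inj m (sg i)) p) by rewrite f_invF.
rewrite (bigD1 (invF (@shift_inj m (sg i)) p)) //= big1 => [|q qp].
  by rewrite addr0; case: imsetP => // -[]; exists i.
case: imsetP => // -[i' _ [/gr_inj <-]] eq_shift.
have eqs : shift (sg i) (invF (@shift_inj m (sg i)) p) = shift (sg i) q.
  exact: val_inj.
by move: qp; rewrite (shift_inj eqs) eqxx.
Qed.

Definition spa_multiple (D : nat) : Prop := forall S, goodset EQ S ->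
  exists2 es : seq (m.-tuple U), {subset es <= EQ} &
    \sum_(f <- es) mass f = indic S *+ D.

(** There are only finitely many sets [S], so their denominators have a common multiple. *)
Lemma exists_spa_multiple : exists2 D, (0 < D)%N & spa_multiple D.
Proof.
apply: common_multiple => [S d e e_gt0 Pd /Pd[es esE sum_es]|S].
  exists (flatten (nseq e es)).
    by move=> f /flattenP[fs]; rewrite mem_nseq => /andP[_ /eqP->] /esE.
  by rewrite big_flatten big_nseq iter_addr_0 sum_es mulrnA.
have [gS|nS] := pselect (goodset EQ S); last by exists 1%N.
by have [D [es [D_gt0 esE sum_es]]] := goodset_spa gS; exists D => // _; exists es.
Qed.

(** The [m] good sets through [a], each covered [D] times by edges, add up to [m * D] copies of [a]
    and [D] full copies of the groups of its extension. *)
Lemma absorbable_opp_pt D a : spa_multiple D -> (ulev a <= 2)%N ->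
  absorbable (- (pt a *+ (m * D))).
Proof.
move=> spaD /ext[gr [sg ea]]; have [gr_inj lev_gr good_a _] := ea.
have /fin_all_exists2[es esE sum_es] q := spaD _ (good_a q).
have -> : - (pt a *+ (m * D)) =
    group_vec (fun j => [exists i, gr i == j] : nat) *+ D -
    \sum_(f <- flatten [seq es q | q <- enum 'I_m]) mass f.
  rewrite big_flatten big_map big_enum /=.
  have aY q : a \notin transversal_set gr sg q := notin_transversal q ea (leqnn _).
  under eq_bigr => q _ do rewrite sum_es (indicU1 (aY q)) mulrnDl.
  rewrite big_split /= sumr_const card_ord -!mulrnA (mulnC D).
  by rewrite sumrMnl -(sum_transversals ea) opprD addrC subrK.
apply: absorbableD; first exact/absorbableMn/absorbable_vec.
by apply: absorbable_edges => f /flatten_mapP[q _] /esE.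
Qed.

(** A multiple of [a] is the same multiple of its whole group minus that of the other vertices of
    the group. Those have the same level as [a], so the preceding lemma covers them too. *)
Lemma balanced_pt D a : spa_multiple D -> low 2 a -> balanced (pt a *+ (m * D)).
Proof.
move=> spaD la; split; last exact: absorbable_opp_pt (lowW la).
case: a la => // -[j p] /= lj.
have -> : pt (inl (j, p)) *+ (m * D) = group_vec (fun j' => j' == j : nat) *+ (m * D)
    + \sum_(q | q != p) - (pt (inl (j, q) : U) *+ (m * D)).
  rewrite sumrN sumrMnl -mulrnBl; congr (_ *+ _).
  apply/esym/eqP; rewrite subr_eq.
  rewrite -(bigD1 p (P := xpredT) (F := fun q => pt (inl (j, q) : U))) //.
  apply/eqP/esym/ffunP => u; rewrite sum_ffunE ffunE; under eq_bigr do rewrite ffunE.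
  case: u => [[j' p']|p']; last by apply: big1.
  rewrite (bigD1 p') //= big1 => [|q qp'].
    by rewrite addr0 (inj_eq (@inl_inj _ _)) xpair_eqE eqxx andbT.
  by rewrite (inj_eq (@inl_inj _ _)) xpair_eqE [p' == q]eq_sym (negPf qp') andbF.
apply: absorbableD; first exact/absorbableMn/absorbable_vec.
by apply: absorbable_sum => q _; apply: absorbable_opp_pt.
Qed.

(** The negative is absorbable because [f] is an edge. For the other sign, [mass f] is [m * D] times
    itself, which is absorbable vertex by vertex, plus [m * D - 1] copies of [- mass f]. *)
Lemma balanced_mass f : f \in EQ -> (forall i, low 2 (tnth f i)) ->
  balanced (mass f).
Proof.
move=> fE lf; have [D D_gt0 spaD] := exists_spa_multiple.
have abs_f : absorbable (- mass f).
  have -> : mass f = \sum_(g <- [:: f]) mass g by rewrite big_seq1.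
  by apply: absorbable_edges => g; rewrite inE => /eqP->.
split=> //; have -> : mass f = mass f *+ (m * D) + (- mass f) *+ (m * D).-1.
  rewrite mulNrn -mulrnBr ?leq_pred // -subn1 subKn ?mulr1n //.
  by rewrite muln_gt0 m_gt0.
apply: absorbableD; last exact: absorbableMn.
rewrite mass_sum -sumrMnl; apply: absorbable_sum => i _.
by have [] := balanced_pt spaD (lf i).
Qed.

(** Here [Div] enters: its weights may be negative, but balanced vectors form a group. *)
Lemma balanced_indic S : goodset EQ S -> {in S, forall u, low 2 u} ->
  balanced (indic S).
Proof.
move=> gS lS; have [w ->] := goodset_div gS.
apply: balanced_sum => f /andP[fE /forallP fS].
by apply/balancedMz/balanced_mass => // i; apply/lS/fS.
Qed.

Lemma low_pivot l : low l (inl z).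
Proof. by case: z lev_z => j p /= ->. Qed.

(** Some transversal completes both [t] and the pivot, and cancels from the difference of the two
    good sets. It lies one level above [t], hence the bound 1 on the level. *)
Lemma balanced_exchange t : low 1 t -> balanced (pt t - pt (inl z)).
Proof.
move=> lt; have ut := lowW lt.
have [gr [sg et]] := ext (leqW ut).
have [_ _ good_t [q good_z]] := et.
have lY u : u \in transversal_set gr sg q -> low 2 u.
  by move=> /(low_transversal et); apply: low_leq.
have zY : inl z \notin transversal_set gr sg q.
  by apply: (notin_transversal q et); case: z lev_z => j p /= ->.
have tY : t \notin transversal_set gr sg q := notin_transversal q et (leqnn _).
have -> : pt t - pt (inl z) = indic (t |: transversal_set gr sg q) -
    indic (inl z |: transversal_set gr sg q).
  by rewrite (indicU1 tY) (indicU1 zY) opprD addrACA subrr addr0.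
apply: balancedB; apply: balanced_indic => // u; rewrite in_setU1.
  by case/predU1P => [->|/lY //]; apply: low_leq lt.
by case/predU1P => [->|/lY //]; exact: low_pivot.
Qed.

(** An edge inside a good set through the pivot has all entries on levels at most 1; exchanging each
    of them for the pivot leaves [m] copies of it. *)
Lemma balanced_pivot : balanced (pt (inl z) *+ m).
Proof.
have [|gr [sg ez]] := ext (a := inl z); first exact: lowW (low_pivot 2).
have [_ _ good_z _] := ez.
have uz : ulev (inl z) = 0%N by apply/eqP; rewrite -leqn0 lowW ?low_pivot.
have [f [fE fS _]] := goodset_cov (good_z (Ordinal m_gt0)) (setU11 _ _).
have l1 i : low 1 (tnth f i).
  have := fS i; rewrite in_setU1 => /predU1P[->|]; first exact: low_pivot.
  by move=> /(low_transversal ez); rewrite uz.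
have -> : pt (inl z) *+ m = mass f - \sum_i (pt (tnth f i) - pt (inl z)).
  by rewrite sumrB -mass_sum sumr_const card_ord subKr.
apply: balancedB.
  by apply: balanced_mass => // i; apply: low_leq (l1 i).
by apply: balanced_sum => i _; apply: balanced_exchange.
Qed.

(** [Cov] gives an edge through the root [inr p] with multiplicity one. Its other [m - 1] entries
    lie in the transversal, on level 1, and are exchangeable for the pivot. *)
Lemma balanced_cover (p : 'I_m) : exists2 f, f \in EQ &
  balanced (mass f - pt (inr p) - pt (inl z) *+ m.-1).
Proof.
have [//|gr [sg ep]] := ext (a := inr p); have [_ _ good_p _] := ep.
have [f [fE fS fp]] := goodset_cov (good_p (Ordinal m_gt0)) (setU11 _ _).
exists f => //; have /cards1P[i0 fi0] : #|[set i | tnth f i == inr p]| == 1%N.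
  exact/eqP.
have fiE i : (tnth f i == inr p) = (i == i0).
  by have /setP/(_ i) := fi0; rewrite !inE.
have -> : mass f - pt (inr p) - pt (inl z) *+ m.-1 =
    \sum_(i | i != i0) (pt (tnth f i) - pt (inl z)).
  rewrite mass_sum (bigD1 i0) //= (eqP (_ : tnth f i0 == inr p)) ?fiE //.
  rewrite [pt _ + _]addrC addrK sumrB sumr_const cardC1 card_ord //.
apply: balanced_sum => i ii0; apply: balanced_exchange.
have := fS i; rewrite in_setU1 fiE (negPf ii0) /=.
exact: (low_transversal ep).
Qed.

(** Adding up the covering edges of all [m] roots leaves [m * (m - 1)] pivots, a multiple of [m],
    which are balanced by [balanced_pivot]. Absorbing the remainder completes the roots and full
    groups to a sum of edges. *)
Lemma absorbing_combination : exists (c : J -> nat) (es : seq (m.-tuple U)),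
  {subset es <= EQ} /\
  \sum_(f <- es) mass f = group_vec c + \sum_p pt (inr p).
Proof.
have /fin_all_exists2[f fE fbal] := balanced_cover.
have [[c [es [esE ces]]] _] : balanced (\sum_p (mass (f p) - pt (inr p))).
  have -> : \sum_p (mass (f p) - pt (inr p)) =
    \sum_p (mass (f p) - pt (inr p) - pt (inl z) *+ m.-1) + pt (inl z) *+ m *+ m.-1.
    by rewrite [in RHS]sumrB sumr_const card_ord mulrnAC subrK.
  apply: balancedD; last exact/balancedMn/balanced_pivot.
  by apply: balanced_sum => p _; apply: fbal.
exists c, ([seq f p | p <- enum 'I_m] ++ es); split.
  by move=> g; rewrite mem_cat => /orP[/mapP[p _ ->]|/esE].
by rewrite big_cat /= big_map big_enum -ces sumrB addrAC subrK.
Qed.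

End Absorbable.

(** * Fissile blow-ups *)

Section Greedy.

Variables (m : nat) (U T : finType) (H : digraph m T) (EQ : {set m.-tuple U}).
Hypothesis fisH : fissile H.

Lemma tnth_inj (e : m.-tuple T) : uniq e -> injective (tnth e).
Proof. by move=> ue; apply/tuple_uniqP. Qed.

(** A blow-up needs non-empty parts, while the parts are used up in the course of the matching;
    edges through an exhausted part are dropped. *)
Definition nonempty_part_edges (V : U -> {set T}) : {set m.-tuple U} :=
  [set f in EQ | [forall i, V (tnth f i) != finset.set0]].

Lemma nonempty_part_edgesP (V : U -> {set T}) (f : m.-tuple U) :
  f \in nonempty_part_edges V ->
  forall i, tnth f i \in [set u | V u != finset.set0].
Proof. by rewrite inE => /andP[_ /forallP fV] i; rewrite inE. Qed.

(** Edges are embedded one by one: fissility gives an injective edge for the first [f], whose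
    vertices are then deleted from the parts. The sum condition makes [f] ample, persists after the
    deletion, and makes the parts run out exactly at the end. *)
Lemma fissile_matching (V : U -> {set T}) (es : seq (m.-tuple U)) :
  (forall u, V u \subset verts H) ->
  (forall u v, u != v -> [disjoint V u & V v]) ->
  (forall f e, f \in EQ -> strictly_preserving V f e -> e \in edges H) ->
  {subset es <= EQ} ->
  (forall u, \sum_(f <- es) mult u f = #|V u|) ->
  exists2 M : {set m.-tuple T}, matching H M &
    forall v, (exists u, v \in V u) <-> exists2 e, e \in M & v \in e.
Proof.
elim: es V => [|f es IHes] V VH disV stV esE sumV.
  exists finset.set0.
    split=> [|e|e f v]; rewrite ?inE //; exact: finset.sub0set.
  move=> v; split=> [[u]|[e]]; rewrite ?inE //.
  by have /esym/eqP := sumV u; rewrite big_nil cards_eq0 => /eqP->; rewrite inE.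
have fE : f \in EQ by apply: esE; rewrite mem_head.
have multV u : mult u f <= #|V u| by rewrite -sumV big_cons leq_addr.
have mult_gt0 i : 0 < mult (tnth f i) f.
  by apply/card_gt0P; exists i; rewrite inE.
have fV i : V (tnth f i) != finset.set0.
  by rewrite -card_gt0; apply: leq_trans (multV _).
pose Q := Digraph (@nonempty_part_edgesP V).
have famQ : blowup_family Q V.
  by split=> [u|u v _ _]; [rewrite inE|exact: disV].
have subQ : subdigraph (blowup Q V) H.
  split; first by apply/bigcupsP => u _; exact: VH.
  apply/fintype.subsetP => e; rewrite inE => /exists_inP[g].
  by rewrite inE => /andP[gE _]; exact: stV.
have fQ : f \in edges Q by rewrite inE fE; apply/forallP.
have [|e [eH fe ue]] := fisH famQ subQ fQ; first by move=> i; exact: multV.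
have e_inj := tnth_inj ue.
have eV i : tnth e i \in V (tnth f i) by have /forallP := fe.
have disE u v x : x \in V u -> x \in V v -> u = v.
  move=> xu xv; apply: contraTeq xv => /disV.
  by rewrite disjoint_subset => /fintype.subsetP/(_ x xu).
pose V' u := V u :\: [set x in e].
have V'sub u : V' u \subset V u := subsetDl _ _.
have cardV' u : #|V u| = mult u f + #|V' u|.
  rewrite -(cardsID [set x in e] (V u)); congr (_ + _).
  rewrite /mult -(card_imset _ e_inj); apply: eq_card => x.
  rewrite !inE; apply/andP/imsetP => [[xu /tnthP[i xi]]|[i]].
    by exists i; rewrite // inE; apply/eqP/(disE _ _ x); rewrite // xi.
  by rewrite inE => /eqP<- ->; split=> //; exact: mem_tnth.
have [||||u|M [ME Muniq Mdis] Mcov] := IHes V'.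
- by move=> u; apply: fintype.subset_trans (VH u).
- by move=> u v /disV; apply: disjointW.
- move=> g d gE /andP[/forallP gd eqd]; apply: stV (gE) _.
  apply/andP; split=> //; apply/forallP => i.
  by apply: (fintype.subsetP (V'sub _)); exact: gd.
- by move=> g ges; apply: esE; rewrite inE ges orbT.
- by apply/eqP; rewrite -(eqn_add2l (mult u f)) -cardV' -sumV big_cons.
have Me d v : d \in M -> v \in d -> v \in e -> False.
  move=> dM vd ve; have /Mcov[u] : exists2 d, d \in M & v \in d by exists d.
  by rewrite !inE ve.
exists (e |: M).
  split.
  - by apply/fintype.subsetP => d /setU1P[->//|/(fintype.subsetP ME)].
  - by move=> d /setU1P[->//|/Muniq].
  - move=> d d' v /setU1P[->|dM] /setU1P[->|d'M] vd vd' //.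
    + by case: (Me _ _ d'M vd' vd).
    + by case: (Me _ _ dM vd vd').
    + exact: Mdis vd vd'.
move=> v; split=> [[u vu]|[d /setU1P[->|dM] vd]].
- have [ve|ve] := boolP (v \in e); first by exists e; rewrite // setU11.
  have /Mcov[d dM vd] : exists u, v \in V' u by exists u; rewrite !inE ve.
  by exists d; rewrite // setU1r.
- by have /tnthP[i ->] := vd; exists (tnth f i).
- have /Mcov[u] : exists2 d, d \in M & v \in d by exists d.
  by move=> /(fintype.subsetP (V'sub u)); exists u.
Qed.

End Greedy.

(** * Counting extensions *)

Lemma sum_card_preimset (I J : finType) (f : I -> J) (B : {set J}) :
  \sum_(b in B) #|[set i | f i == b]| = #|[set i | f i \in B]|.
Proof.
rewrite -[RHS]sum1dep_card (partition_big f (mem B)) //=.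
apply: eq_bigr => b bB; rewrite -sum1dep_card; apply: eq_bigl => i.
by case: eqP => [->|]; rewrite ?bB ?andbF.
Qed.

Lemma leq_card_bigcup (I T : finType) (B : I -> {set T}) :
  #|\bigcup_i B i| <= \sum_i #|B i|.
Proof.
elim/big_rec2: _ => [|i x S _ IH]; first by rewrite cards0.
by rewrite (leq_trans (leq_card_setU _ _)) // leq_add2l.
Qed.

Lemma card_cover (m : nat) (T A : finType) (g : A -> m.-tuple T) (V : {set T}) :
  (forall a b i j, tnth (g a) i = tnth (g b) j -> a = b /\ i = j) ->
  (forall v, v \in V <-> exists a i, v = tnth (g a) i) ->
  #|V| = #|A| * m.
Proof.
move=> g_inj g_cover; rewrite -[m in RHS]card_ord -card_prod.
have inj : injective (fun p : A * 'I_m => tnth (g p.1) p.2).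
  by move=> [a i] [b j] /g_inj[/= -> ->].
rewrite -(card_imset _ inj) /=; apply: eq_card => v.
apply/idP/imsetP => [/g_cover[a [i ->]]|[[a i] _ ->]]; first by exists (a, i).
by apply/g_cover; exists a, i.
Qed.

Section Extensions.

Variables (m k : nat) (T : finType) (V : {set T}) (PG : {set {set T}}).

Definition completes (a : T) (y : k.-tuple T) : bool := [set x in a :: y] \in PG.

(** Each set of [PG] through [a] contributes the [k!] orderings of its other vertices. *)
Lemma card_completes (a : T) : (forall S, S \in PG -> #|S| = k.+1) ->
  k`! * #|[set S in PG | a \in S]| <= #|[set y | completes a y]|.
Proof.
move=> cardPG; pose B := [set S in PG | a \in S].
apply: (@leq_trans #|[set y : k.-tuple T | [set x in a :: y] \in B]|); last first.
  apply: subset_leq_card; apply/fintype.subsetP => y; rewrite !inE.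
  by case/andP.
rewrite -sum_card_preimset mulnC -sum_nat_const; apply: leq_sum => S.
rewrite inE => /andP[SP aS].
have cS : #|S :\ a| = k by move: (cardsD1 a S); rewrite aS cardPG //; case.
rewrite -(ffactnn k) -{1}cS -card_uniq_tuples; apply: subset_leq_card.
apply/fintype.subsetP => y; rewrite !inE => /andP[/allP ySa uy].
rewrite eqEcard (cardPG S) //; apply/andP; split.
  apply/fintype.subsetP => x; rewrite !inE => /predU1P[->//|/ySa].
  by case/setD1P.
have ay : uniq (a :: y).
  by rewrite /= uy andbT; apply/negP => /ySa/setD1P[/eqP].
by rewrite cardsE (card_uniqP ay) /= size_tuple.
Qed.

Variables (A : finType) (g : A -> m.-tuple T).

(* The vertex degree condition, freed of fractions and of subtraction. *)
Record setting : Prop := Setting {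
  setting_card : forall S, S \in PG -> #|S| = k.+1;
  setting_sub : forall S, S \in PG -> S \subset V;
  setting_degree : forall a, a \in V ->
    k.+1 ^ 2 * 'C(#|V|.-1, k) <=
    k.+1 ^ 2 * #|[set S in PG | a \in S]| + 'C(#|V|.-1, k);
  setting_inj : forall a b i j, tnth (g a) i = tnth (g b) j -> a = b /\ i = j;
  setting_cover : forall v, v \in V <-> exists a i, v = tnth (g a) i
}.

Hypothesis st : setting.
Hypotheses (m_gt1 : 1 < m) (m_le : m <= k.+1).

Lemma setting_cardV : #|V| = #|A| * m.
Proof. exact: card_cover (setting_inj st) (setting_cover st). Qed.

Definition choice_tuple (e : {ffun 'I_k -> A}) (sg : {ffun 'I_k -> 'I_m})
    (q : 'I_m) : k.-tuple T :=
  [tuple tnth (g (e i)) (shift (sg i) q) | i < k].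

Definition ext_pred (a z : T) (e : {ffun 'I_k -> A}) : bool :=
  [exists sg, [forall q, completes a (choice_tuple e sg q)] &&
              [exists q, completes z (choice_tuple e sg q)]].

Let choices := ({ffun 'I_k -> A} * {ffun 'I_k -> 'I_m})%type.

Lemma card_choices : #|{: choices}| = #|V| ^ k.
Proof. by rewrite card_prod !card_ffun !card_ord setting_cardV expnMn. Qed.

(** With [q] fixed, undoing the shift by [q] writes every tuple over [V] as a [choice_tuple]. *)
Lemma card_completing_choices (a : T) (q : 'I_m) :
  #|[set y | completes a y]| <=
  #|[set p : choices | completes a (choice_tuple p.1 p.2 q)]|.
Proof.
apply: leq_trans (leq_imset_card (fun p => choice_tuple p.1 p.2 q) _).
apply: subset_leq_card; apply/fintype.subsetP => y; rewrite inE => ay.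
have yV i : tnth y i \in V.
  apply: (fintype.subsetP (setting_sub st ay)).
  by rewrite !inE mem_tnth orbT.
have /fin_all_exists[e] i : exists a, exists j, tnth y i = tnth (g a) j.
  by apply/(setting_cover st).
case/fin_all_exists => j yE.
pose h := shift_inj (p := q).
have yc : y = choice_tuple (finfun e) [ffun i => invF h (j i)] q.
  apply: eq_from_tnth => i.
  by rewrite yE tnth_mktuple !ffunE shiftC f_invF.
apply/imsetP; exists (finfun e, [ffun i => invF h (j i)]); rewrite ?inE /= -yc //.
Qed.

(** Union bound over [m + 1] bad events: [a] fails for one of the [m] shifts, or [z] fails for the
    shift [q0]. Each event has proportion at most [1 / s ^ 2], where [s = k + 1], plus the
    proportion of tuples counted by [P - F]. *)
Lemma card_ext_pred (a z : T) : a \in V -> z \in V ->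
  8 * m.+1 * (#|V| ^ k - #|V|.-1 ^_ k) <= #|V| ^ k ->
  #|A| ^ k <= 8 * #|[set e | ext_pred a z e]|.
Proof.
move=> aV zV close.
set P := #|V| ^ k in close; set F := #|V|.-1 ^_ k in close.
have m_gt0 : 0 < m by exact: ltnW.
pose q0 := Ordinal m_gt0.
pose bad b q := ~: [set p : choices | completes b (choice_tuple p.1 p.2 q)].
have FP : F <= P by exact: ffact_pred_leq.
have bad_le b q : b \in V -> k.+1 ^ 2 * #|bad b q| <= P + k.+1 ^ 2 * (P - F).
  move=> bV; have /(leq_mul (leqnn k`!)) := setting_degree st bV.
  rewrite mulnDr !(mulnCA k`!) [k`! * 'C(_, _)]mulnC bin_ffact -/F => degF.
  have := card_completes b (setting_card st).
  move/leq_trans/(_ (card_completing_choices b q)).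
  have := cardsC [set p : choices | completes b (choice_tuple p.1 p.2 q)].
  rewrite card_choices -/P -/(bad b q).
  move: #|bad b q| #|[set p : choices | _]| (k`! * _) degF => x y w degF eqP' wy.
  rewrite mulnBr; have : k.+1 ^ 2 * F <= k.+1 ^ 2 * P by rewrite leq_mul2l FP orbT.
  have := leq_mul (leqnn (k.+1 ^ 2)) wy.
  rewrite -eqP' mulnDr; move: (k.+1 ^ 2) degF => s2 degF; lia.
pose badall := bad z q0 :|: \bigcup_q bad a q.
have badall_le : k.+1 ^ 2 * #|badall| <= m.+1 * (P + k.+1 ^ 2 * (P - F)).
  rewrite (leq_trans (leq_mul (leqnn _) (leq_card_setU _ _))) // mulnDr mulSn.
  rewrite leq_add ?bad_le // (leq_trans (leq_mul (leqnn _) (leq_card_bigcup _))) //.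
  rewrite big_distrr -[m in m * _]card_ord -sum_nat_const leq_sum // => q _.
  exact: bad_le.
(* As [2 <= m <= s], the quotient [(m + 1) / s ^ 2] is at most 3/4, and the error terms add at most
   1/8. An eighth of the choices is left. *)
have badall7 : 8 * #|badall| <= 7 * P.
  have le8 : 8 * m.+1 <= 6 * k.+1 ^ 2 by nia.
  rewrite -(@leq_pmul2l (k.+1 ^ 2)) ?expn_gt0 //.
  move: close badall_le le8; move: (k.+1 ^ 2) #|badall| (P - F) => s2 x d.
  move=> close /(leq_mul (leqnn 8)) le_x /leq_mul/(_ (leqnn P)) le8.
  have := leq_mul (leqnn s2) close.
  lia.
have good_ge : P <= 8 * #|~: badall|.
  have := cardsC badall; rewrite card_choices -/P; lia.
have : #|~: badall| <= #|[set e | ext_pred a z e]| * m ^ k.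
  have -> : m ^ k = #|{ffun 'I_k -> 'I_m}| by rewrite card_ffun !card_ord.
  rewrite -cardsT -cardsX; apply: subset_leq_card; apply/fintype.subsetP => -[e sg].
  rewrite !inE negb_or negbK andbT /= => /andP[z_good a_good].
  apply/existsP; exists sg; apply/andP; split; last by apply/existsP; exists q0.
  apply/forallP => q; apply: contraNT a_good => na.
  by apply/finset.bigcupP; exists q; rewrite ?inE.
move=> /(leq_mul (leqnn 8)) /(leq_trans good_ge).
by rewrite /P setting_cardV expnMn mulnA leq_pmul2r // expn_gt0 m_gt0.
Qed.

End Extensions.

(** * Trees of extensions *)

Definition vmap (m : nat) (T A J : finType) (g : A -> m.-tuple T) (x0 : A)
    (h : {ffun J -> A}) (u : J * 'I_m + 'I_m) : T :=
  match u with inl (j, p) => tnth (g (h j)) p | inr p => tnth (g x0) p end.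

Section Config.

Variables (m k : nat) (T : finType) (PG : {set {set T}}) (A : finType).
Variables (g : A -> m.-tuple T) (x0 : A).

(* x0 is the group to be absorbed: its vertices are roots of level 0. *)
Definition config (J : finType) (lev : J -> nat) (z : J * 'I_m) (L : nat)
    (h : {ffun J -> A}) : bool :=
  [forall u : J * 'I_m + 'I_m, (ulev lev u < L) ==>
    [exists gr : {ffun 'I_k -> J}, [&& injectiveb gr,
      [forall i, lev (gr i) == (ulev lev u).+1] &
      ext_pred PG g (vmap g x0 h u) (vmap g x0 h (inl z)) [ffun i => h (gr i)]]]].

Section Step.

Variables (J : finType) (lev : J -> nat) (z : J * 'I_m) (L : nat).
Let U := (J * 'I_m + 'I_m)%type.
Let J' := (J + U * 'I_k)%type.

Definition next_lev (j : J') : nat := if j is inl j then lev j else L.+1.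

Definition glue (p : {ffun J -> A} * {ffun U -> {ffun 'I_k -> A}}) : {ffun J' -> A} :=
  [ffun j' => match j' with inl j => p.1 j | inr (u, i) => p.2 u i end].

Lemma glue_inj : injective glue.
Proof.
move=> [h e] [h' e'] /ffunP eq_glue; congr pair.
  by apply/ffunP => j; have := eq_glue (inl j); rewrite !ffunE.
by apply/ffunP => u; apply/ffunP => i; have := eq_glue (inr (u, i)); rewrite !ffunE.
Qed.

Definition exts (h : {ffun J -> A}) (u : U) : pred {ffun 'I_k -> A} :=
  ext_pred PG g (vmap g x0 h u) (vmap g x0 h (inl z)).

(** A vertex below level [L] keeps its extension and one on level [L] takes its new groups; the
    vertices of new groups are on level [L + 1], where nothing is asked yet. *)
Lemma config_glue h (e : {ffun U -> {ffun 'I_k -> A}}) :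
  config lev z L h -> (forall u, exts h u (e u)) ->
  config next_lev (inl z.1, z.2) L.+1 (glue (h, e)).
Proof.
move=> /forallP conf_h ext_e.
pose lift (u : U) : J' * 'I_m + 'I_m :=
  match u with inl (j, p) => inl (inl j, p) | inr p => inr p end.
have vmap_lift u : vmap g x0 (glue (h, e)) (lift u) = vmap g x0 h u.
  by case: u => [[j p]|p] //=; rewrite ffunE.
have lev_lift u : ulev next_lev (lift u) = ulev lev u by case: u => [[j p]|p].
have vmap_z : vmap g x0 (glue (h, e)) (inl (inl z.1, z.2)) = vmap g x0 h (inl z).
  by case: z => j p /=; rewrite ffunE.
apply/forallP => u'; apply/implyP => lev_u'.
have [u eu'] : exists u, u' = lift u.
  case: u' lev_u' => [[[j|[u i]] p]|p] /=.
  - by exists (inl (j, p)).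
  - by rewrite ltnn.
  - by exists (inr p).
rewrite {u'}eu' lev_lift vmap_lift vmap_z in lev_u' *.
have [lev_u|lev_u] := ltnP (ulev lev u) L.
  have /implyP/(_ lev_u)/existsP[gr /and3P[/injectiveP gr_inj /forallP lev_gr ext_gr]]
    := conf_h u.
  apply/existsP; exists [ffun i => inl (gr i)]; apply/and3P; split.
  - by apply/injectiveP => i j; rewrite !ffunE => -[/gr_inj].
  - by apply/forallP => i; rewrite ffunE /=.
  - congr (ext_pred _ _ _ _ _): ext_gr.
    by apply/ffunP => i; rewrite !ffunE.
have lev_uL : ulev lev u = L by apply/eqP; rewrite eqn_leq lev_u -ltnS lev_u'.
apply/existsP; exists [ffun i => inr (u, i)]; apply/and3P; split.
- by apply/injectiveP => i j; rewrite !ffunE => -[].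
- by apply/forallP => i; rewrite ffunE /= lev_uL.
- congr (ext_pred _ _ _ _ _): (ext_e u).
  by apply/ffunP => i; rewrite !ffunE.
Qed.

Lemma card_family_ge (aT rT : finType) (F : aT -> pred rT) (c M : nat) :
  (forall x, M <= c * #|F x|) -> M ^ #|aT| <= c ^ #|aT| * #|family F|.
Proof.
move=> leF; rewrite card_family foldrE big_map big_enum /=.
by rewrite -!prod_nat_const -big_split; apply: leq_prod => x _.
Qed.

(** Given [h], the extensions of the vertices [u] are chosen independently, each with density at
    least 1/8, so the densities multiply. *)
Lemma config_step (c : nat) :
  (forall h u, #|A| ^ k <= 8 * #|exts h u|) ->
  #|{ffun J -> A}| <= c * #|[set h | config lev z L h]| ->
  #|{ffun J' -> A}| <= c * 8 ^ #|{: U}| *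
    #|[set h | config next_lev (inl z.1, z.2) L.+1 h]|.
Proof.
move=> leE leC.
have eqK : #|{ffun J' -> A}| = #|{ffun J -> A}| * (#|A| ^ k) ^ #|{: U}|.
  by rewrite !card_ffun card_sum card_prod card_ord expnD (mulnC #|{: U}|) expnM.
pose X := [set p : {ffun J -> A} * {ffun U -> {ffun 'I_k -> A}} |
  config lev z L p.1 && (p.2 \in family (exts p.1))].
have leX : #|X| <= #|[set h | config next_lev (inl z.1, z.2) L.+1 h]|.
  rewrite -(card_imset _ glue_inj); apply: subset_leq_card.
  apply/fintype.subsetP => w /imsetP[[h e]].
  rewrite [_ \in X]inE => /andP[/= ch /familyP he] ->.
  by rewrite inE config_glue // => u; exact: he.
have cardX : #|X| = \sum_(h | config lev z L h) #|family (exts h)|.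
  rewrite -sum1dep_card; under [RHS]eq_bigr do rewrite -sum1_card.
  by rewrite pair_big_dep.
rewrite eqK (leq_trans (leq_mul leC (leqnn _))) // -!mulnA leq_mul2l; apply/orP; right.
apply: leq_trans (leq_mul (leqnn _) leX); rewrite cardX big_distrr /= cardsE.
rewrite -sum_nat_const; apply: leq_sum => h _.
exact: card_family_ge.
Qed.

End Step.
End Config.

Lemma config_dense (m k L : nat) : 1 < m -> m <= k.+1 ->
  exists (J : finType) (lev : J -> nat) (z : J * 'I_m) (c N0 : nat),
  lev z.1 = 0 /\
    (forall (T : finType) (V : {set T}) (PG : {set {set T}}) (A : finType)
      (g : A -> m.-tuple T) (x0 : A),
    setting k V PG g -> N0 <= #|A| ->
    #|{ffun J -> A}| <= c * #|[set h | config k PG g x0 lev z L h]|).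
Proof.
move=> m_gt1 m_le; have m_gt0 := ltnW m_gt1.
elim: L => [|L [J [lev [z [c [N0 [lev_z dense]]]]]]].
  (* The tree starts from a single group on level 0, which contains the pivot. *)
  exists unit, (fun=> 0), (tt, Ordinal m_gt0), 1, 0; split=> // T V PG A g x0 _ _.
  rewrite mul1n; apply: subset_leq_card; apply/fintype.subsetP => h _.
  by rewrite inE; apply/forallP => u; rewrite ltn0.
have [n0 close] := expn_ffact_close k (8 * m.+1).
exists (J + (J * 'I_m + 'I_m) * 'I_k)%type, (next_lev lev L), (inl z.1, z.2).
exists (c * 8 ^ #|{: J * 'I_m + 'I_m}|), (N0 + n0); split=> //.
move=> T V PG A g x0 st leA; apply: config_step => // [h u|].
  have vmapV v : vmap g x0 h v \in V.
    by apply/(setting_cover st); case: v => [[j p]|p] /=; eexists; eexists.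
  have close_V : 8 * m.+1 * (#|V| ^ k - #|V|.-1 ^_ k) <= #|V| ^ k.
    apply: close; rewrite (setting_cardV st); apply: leq_trans (leq_pmulr _ m_gt0).
    exact: leq_trans (leq_addl _ _) leA.
  have := card_ext_pred st m_gt1 m_le (vmapV u) (vmapV (inl z)) close_V.
  by rewrite cardsE.
by apply: (dense _ V) => //; exact: leq_trans (leq_addr _ _) leA.
Qed.

(** * The digraph of a tree of extensions *)

Section TypeDigraph.

Variables (m k : nat) (T A J : finType) (g : A -> m.-tuple T) (x0 : A).
Variable H : digraph m T.
Local Notation U := (J * 'I_m + 'I_m)%type.

Definition same_group (u v : U) : bool :=
  match u, v with inl (j, _), inl (j', _) => j == j' | _, _ => false end.

Definition one_per_group (f : m.-tuple U) : bool :=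
  [forall i, forall l, same_group (tnth f i) (tnth f l) ==> (tnth f i == tnth f l)].

(* Blowing up the groups replaces the vertices of one group independently of
   each other, so only edges with at most one vertex per group survive. *)
Definition type_edges (h : {ffun J -> A}) : {set m.-tuple U} :=
  [set f | one_per_group f & map_tuple (vmap g x0 h) f \in edges H].

Hypothesis g_inj : forall a b i j, tnth (g a) i = tnth (g b) j -> a = b /\ i = j.

Lemma vmap_inj (h : {ffun J -> A}) : injective h -> (forall j, h j != x0) ->
  injective (vmap g x0 h).
Proof.
move=> h_inj h_x0 [[j p]|p] [[j' p']|p'] /= /g_inj[].
- by move=> /h_inj -> ->.
- by move=> /eqP; rewrite (negPf (h_x0 j)).
- by move=> /esym/eqP; rewrite (negPf (h_x0 j')).
- by move=> _ ->.
Qed.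

Variables (R : realType).
Let PG := property_graph k.+1 H (Spa R `&` Div `&` Cov)%classic.

(** The set has at most one vertex in each group, as [gr] is injective and [b] lies in none of its
    groups. Hence every edge of [H] inside its image comes from [type_edges]. *)
Lemma goodset_completes (h : {ffun J -> A}) (b : U) (gr : {ffun 'I_k -> J})
    (sg : {ffun 'I_k -> 'I_m}) (q : 'I_m) :
  injective h -> (forall j, h j != x0) -> injective gr ->
  (forall i p, ~~ same_group b (inl (gr i, p))) ->
  completes PG (vmap g x0 h b) (choice_tuple g [ffun i => h (gr i)] sg q) ->
  goodset (type_edges h) (b |: transversal_set gr sg q).
Proof.
move=> h_inj h_x0 gr_inj b_gr; rewrite /completes.
set S := b |: _.
have -> : [set x in vmap g x0 h b :: choice_tuple g [ffun i => h (gr i)] sg q] =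
    vmap g x0 h @: S.
  apply/setP => x; rewrite !inE imsetU1 in_setU1; congr (_ || _).
  rewrite -imset_comp; apply/tnthP/imsetP => [[i ->]|[i _ ->]].
    by exists i; rewrite // tnth_mktuple ffunE.
  by exists i; rewrite tnth_mktuple ffunE.
rewrite inE => /and3P[_ _ /asboolP]; apply: goodset_transport.
  exact: vmap_inj.
apply/fintype.subsetP => f; rewrite !inE => /andP[/forallP fS ->].
rewrite andbT; apply/forallP => i; apply/forallP => l; apply/implyP.
have := fS i; have := fS l.
rewrite !in_setU1 => /predU1P[->|/imsetP[i1 _ ->]] /predU1P[->|/imsetP[i2 _ ->]] //.
- have sC u v : same_group u v = same_group v u.
    by case: u v => [[? ?]|?] [[? ?]|?] //=; rewrite eq_sym.
  by rewrite sC (negPf (b_gr _ _)).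
- by rewrite (negPf (b_gr _ _)).
- by move=> /eqP/gr_inj ->.
Qed.

Lemma config_combination (lev : J -> nat) (z : J * 'I_m) (h : {ffun J -> A}) :
  0 < m -> lev z.1 = 0 -> injective h -> (forall j, h j != x0) ->
  config k PG g x0 lev z 3 h ->
  exists (c : J -> nat) (es : seq (m.-tuple U)), {subset es <= type_edges h} /\
    (\sum_(f <- es) mass f = group_vec m c + \sum_p pt (inr p))%R.
Proof.
move=> m_gt0 lev_z h_inj h_x0 /forallP conf.
apply: (@absorbing_combination m J (type_edges h) k lev z m_gt0 lev_z) => a lev_a.
have /implyP/(_ lev_a)/existsP[gr /and3P[/injectiveP gr_inj /forallP lev_gr]] := conf a.
case/existsP => sg /andP[/forallP comp_a /existsP[q comp_z]].
have lev_grE i : lev (gr i) = (ulev lev a).+1 := eqP (lev_gr i).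
exists gr, sg; split=> // [q'|].
  apply: goodset_completes => // i p.
  case: a lev_grE {lev_a lev_gr comp_a} => // -[j p'] /= lev_grE.
  by apply/eqP => jE; have := lev_grE i; rewrite -jE; apply: n_Sn.
exists q; apply: goodset_completes => // i p /=.
case: z lev_z {comp_z conf} => j p' /= lev_j.
by apply/eqP => jE; have := lev_grE i; rewrite -jE lev_j.
Qed.

End TypeDigraph.

(** * Absorbing one group *)

(** The size of the box has to be fixed before the edge set [EQ] is known; only finitely many [EQ]
    exist, so one bound on the coefficients serves all. *)
Lemma bounded_combination (m : nat) (J : finType) :
  exists b : nat, forall EQ : {set m.-tuple (J * 'I_m + 'I_m)},
    (exists (c : J -> nat) (es : seq _), {subset es <= EQ} /\
      (\sum_(f <- es) mass f = group_vec m c + \sum_p pt (inr p))%R) ->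
    exists (c : J -> nat) (es : seq _), [/\ {subset es <= EQ}, forall j, c j <= b &
      (\sum_(f <- es) mass f = group_vec m c + \sum_p pt (inr p))%R].
Proof.
pose P (EQ : {set m.-tuple (J * 'I_m + 'I_m)}) (b : nat) :=
  (exists (c : J -> nat) (es : seq _), {subset es <= EQ} /\
      (\sum_(f <- es) mass f = group_vec m c + \sum_p pt (inr p))%R) ->
    exists (c : J -> nat) (es : seq _), [/\ {subset es <= EQ}, forall j, c j <= b &
      (\sum_(f <- es) mass f = group_vec m c + \sum_p pt (inr p))%R].
have /fin_all_exists[b Pb] EQ : exists b, P EQ b.
  have [[c [es [esE sum_es]]]|nex] := pselect (exists (c : J -> nat) (es : seq _),
      {subset es <= EQ} /\
      (\sum_(f <- es) mass f = group_vec m c + \sum_p pt (inr p))%R); last by exists 0.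
  exists (\max_j c j) => _; exists c, es; split=> // j; exact: leq_bigmax.
exists (\max_EQ b EQ) => EQ /Pb[c [es [esE cb sum_es]]].
exists c, es; split=> // j; apply: leq_trans (cb j) _; exact: leq_bigmax.
Qed.

Lemma pigeonhole_fiber (I X : finType) (f : I -> X) (B : {set I}) (c K : nat) :
  0 < K -> K <= c * #|B| ->
  exists x, K <= c * #|X| * #|[set i in B | f i == x]|.
Proof.
move=> K_gt0 leK; apply: contrapT => nex.
have lt x : c * #|X| * #|[set i in B | f i == x]| < K.
  by rewrite ltnNge; apply/negP => ?; apply: nex; exists x.
have sumB : #|B| = \sum_x #|[set i in B | f i == x]|.
  rewrite -sum1_card (partition_big f xpredT) //=; apply: eq_bigr => x _.
  by rewrite -sum1dep_card.
have [X0|X_gt0] := posnP #|X|.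
  have : #|B| = 0 by rewrite sumB big_pred0 // => x; move: (fintype0 x X0).
  move=> B0; by move: leK; rewrite B0 muln0 leqNgt K_gt0.
have : \sum_(x : X) c * #|X| * #|[set i in B | f i == x]| < \sum_(x : X) K.
  have [x _] := card_gt0P X_gt0.
  rewrite (bigD1 x) //= [X in _ < X](bigD1 x) //= -addSn leq_add //.
  by apply: leq_sum => y _; apply: ltnW.
rewrite -big_distrr /= -sumB sum_nat_const -mulnA mulnCA ltn_pmul2l //.
by rewrite ltnNge leK.
Qed.

Lemma setting_property_graph (R : realType) (m k : nat) (T A : finType)
    (g : A -> m.-tuple T) (H : digraph m T) :
  robustly_satisfies k.+1 H (Spa R `&` Div `&` Cov)%classic ->
  (forall a b i j, tnth (g a) i = tnth (g b) j -> a = b /\ i = j) ->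
  (forall v, v \in verts H <-> exists a i, v = tnth (g a) i) ->
  setting k (verts H) (property_graph k.+1 H (Spa R `&` Div `&` Cov)%classic) g.
Proof.
move=> rob g_inj g_cover; split=> //.
- by move=> S; rewrite inE => /and3P[_ /eqP].
- by move=> S; rewrite inE => /and3P[].
move=> a /rob /=; set C := 'C(_, _); set B := #|_|.
have s_gt0 : (0 < k.+1%:R ^+ 2 :> rat)%R by rewrite exprn_gt0 ?ltr0n.
rewrite -(ler_pM2l s_gt0) mulrA mulrBr mulr1 div1r mulfV ?gt_eqF // mulrBl mul1r.
by rewrite lerBlDr -natrX -!natrM -natrD ler_nat.
Qed.

(** To be applied to a group [x0] that is not an edge: trading the groups in [B] for the edges in
    [M] then increases the number of edges in a frame. *)
Lemma augmentation (R : realType) (m k : nat) : 1 < m -> m <= k.+1 ->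
  exists N0 : nat, forall (T A : finType) (g : A -> m.-tuple T) (H : digraph m T),
    (forall a b i j, tnth (g a) i = tnth (g b) j -> a = b /\ i = j) ->
    (forall v, v \in verts H <-> exists a i, v = tnth (g a) i) ->
    fissile H ->
    robustly_satisfies k.+1 H (Spa R `&` Div `&` Cov)%classic ->
    N0 <= #|A| -> forall x0 : A,
  exists (B : {set A}) (M : {set m.-tuple T}), [/\ x0 \in B, matching H M &
    forall v, (exists a i, a \in B /\ v = tnth (g a) i) <->
              exists2 e, e \in M & v \in e].
Proof.
move=> m_gt1 m_le; have m_gt0 := ltnW m_gt1.
have [J [lev [z [c [N1 [lev_z dense]]]]]] := @config_dense m k 3 m_gt1 m_le.
have [b comb] := bounded_combination m J.
(* With the factor [2 * c], the maps [h] that are not injective or take the value [x0] cost at most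
   half of the density [1 / c]. *)
have [N2 close] := expn_ffact_close #|J| (2 * c).
pose c' := 2 * c * #|{set m.-tuple (J * 'I_m + 'I_m)}|.
(* The clusters get size [b + 1] so that they are non-empty even if [b = 0]. *)
have [N3 box] := dense_box #|J| b.+1 c'.
exists (N1 + N2 + N3).+1 => T A g H g_inj g_cover fisH rob leA x0.
have st := setting_property_graph rob g_inj g_cover.
set PG := property_graph _ _ _ in st.
have leN1 : N1 <= #|A| by apply: leq_trans (ltnW leA); rewrite -addnA leq_addr.
have leN2 : N2 <= #|A|.
  by apply: leq_trans (ltnW leA); rewrite addnAC leq_addl.
have leN3 : N3 <= #|A| by apply: leq_trans (ltnW leA); rewrite leq_addl.
have A_gt0 : 0 < #|A| by exact: leq_trans leA.
pose inj_h (h : {ffun J -> A}) := injectiveb h && [forall j, h j != x0].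
pose G := [set h : {ffun J -> A} | config k PG g x0 lev z 3 h & inj_h h].
have K_gt0 : 0 < #|{ffun J -> A}|.
  by apply/card_gt0P; exists [ffun=> x0].
have leG : #|{ffun J -> A}| <= 2 * c * #|G|.
  have := dense T (verts H) PG A g x0 st leN1.
  set C := [set h | _] => leC.
  have leI : 2 * c * #|~: [set h | inj_h h]| <= #|{ffun J -> A}|.
    rewrite card_ffun; apply: leq_trans (close _ leN2); rewrite leq_mul2l.
    apply/orP; right; have := cardsC [set h | inj_h h]; rewrite card_ffun.
    have : #|A|.-1 ^_ #|J| <= #|[set h | inj_h h]|.
      have := card_inj_ffuns_on J (predC1 x0); rewrite cardC1 => <-.
      apply: subset_leq_card; apply/fintype.subsetP => h.
      rewrite !inE => /andP[/ffun_onP h_x0 h_inj]; apply/andP; split=> //.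
      by apply/forallP => j; have := h_x0 j; rewrite inE.
    move: #|~: [set h | inj_h h]| #|[set h | inj_h h]| (_ ^_ _) (#|A| ^ _) => x y d e.
    lia.
  have : #|C| <= #|G| + #|~: [set h | inj_h h]|.
    rewrite -(cardsID [set h | inj_h h]) leq_add //; apply: subset_leq_card.
      by apply/fintype.subsetP => h; rewrite !inE.
    by apply/fintype.subsetP => h; rewrite !inE => /andP[].
  move/(leq_mul (leqnn (2 * c))); rewrite mulnDr.
  move: leC leI; rewrite -mulnA.
  move: (2 * c * #|~: [set h | inj_h h]|) #|{ffun J -> A}| => x y.
  lia.
have [EQ leEQ] := pigeonhole_fiber (type_edges g x0 H) K_gt0 leG.
have [W cardW boxW] := box A J _ erefl leN3 leEQ.
have {boxW} inW (h : {ffun J -> A}) : (forall j, h j \in W j) ->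
    [/\ config k PG g x0 lev z 3 h, injective h, forall j, h j != x0 &
        type_edges g x0 H h = EQ].
  move=> /boxW; rewrite inE [_ \in G]inE.
  by case/andP=> /and3P[conf /injectiveP ? /forallP ?] /eqP.
have W_gt0 j : exists a, a \in W j by apply/card_gt0P; rewrite cardW.
have [h0 h0W] : exists h0 : {ffun J -> A}, forall j, h0 j \in W j.
  have /fin_all_exists[h hW] := W_gt0.
  by exists (finfun h) => j; rewrite ffunE.
have [cn [es [esE cn_le sum_es]]] : exists (c : J -> nat) (es : seq _),
    [/\ {subset es <= EQ}, forall j, c j <= b &
      (\sum_(f <- es) mass f = group_vec m c + \sum_p pt (inr p))%R].
  apply: comb; have [conf h_inj h_x0 <-] := inW _ h0W.
  exact: (config_combination g_inj m_gt0 lev_z h_inj h_x0 conf).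
have /fin_all_exists2[W' W'W cardW'] j : exists2 S : {set A}, S \subset W j & #|S| = cn j.
  have /card_geqP[t [ut st_t tW]] : cn j <= #|W j| by rewrite cardW leqW.
  exists [set x in t]; last by rewrite cardsE (card_uniqP ut).
  by apply/fintype.subsetP => x; rewrite inE => /tW.
pose Vc (u : J * 'I_m + 'I_m) : {set T} := match u with
  | inl (j, p) => [set tnth (g a) p | a in W' j]
  | inr p => [set tnth (g x0) p] end.
(* A common element of two clusters would give a map in the box taking it twice, yet all maps in the
   box are injective. *)
have W_disj j j' a : a \in W j -> a \in W j' -> j = j'.
  move=> aj aj'; pose h := [ffun i => if (i == j) || (i == j') then a else h0 i].
  have [|_ h_inj _ _] := inW h; last by apply: h_inj; rewrite !ffunE !eqxx orbT.
  by move=> i; rewrite ffunE; case: ifP => // /orP[]/eqP->.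
have W_x0 j : x0 \notin W j.
  apply/negP => x0j; pose h := [ffun i => if i == j then x0 else h0 i].
  have [|_ _ /(_ j)] := inW h; last by rewrite ffunE eqxx eqxx.
  by move=> i; rewrite ffunE; case: eqP => // ->.
have W'_in j a : a \in W' j -> a \in W j := fintype.subsetP (W'W j) a.
have Vc_V u : Vc u \subset verts H.
  apply/fintype.subsetP => v vu; apply/g_cover; case: u vu => [[j p]|p] /=.
    by case/imsetP => a _ ->; exists a, p.
  by move/set1P => ->; exists x0, p.
have Vc_disj u v : u != v -> [disjoint Vc u & Vc v].
  apply: contraR => /pred0Pn[x /andP[/= xu xv]]; apply/eqP.
  case: u v xu xv => [[j p]|p] [[j' p']|p'] /=.
  - move=> /imsetP[a /W'_in aj ->] /imsetP[a' /W'_in aj' /g_inj[eq_a ->]].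
    by rewrite eq_a in aj; rewrite (W_disj _ _ _ aj aj').
  - move=> /imsetP[a /W'_in aj ->] /set1P/g_inj[eq_a _].
    by move: (W_x0 j); rewrite -eq_a aj.
  - move=> /set1P-> /imsetP[a /W'_in aj /g_inj[eq_a _]].
    by move: (W_x0 j'); rewrite eq_a aj.
  - by move=> /set1P-> /set1P/g_inj[_ ->].
(* As [f] meets each group in at most one vertex, possibly repeated, [e] uses one group from each
   cluster that it meets. Thus [e] is the image of [f] under a map in the box, and all these maps
   have the same edges [EQ]. *)
have Vc_strict f e : f \in EQ -> strictly_preserving Vc f e -> e \in edges H.
  move=> fE /andP[/forallP e_pres /forallP e_eq].
  have opf : one_per_group f.
    have [_ _ _ EQ0] := inW _ h0W.
    by move: fE; rewrite -EQ0 inE => /andP[].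
  have /fin_all_exists[al alP] l : exists a, forall j p, tnth f l = inl (j, p) ->
      a \in W j /\ tnth e l = tnth (g a) p.
    have := e_pres l; case: (tnth f l) => [[j p]|p] /=; last by exists x0.
    by case/imsetP => a /W'_in aj ->; exists a => _ _ [<- <-].
  (* On clusters that [f] misses, [h] takes the default value [h0 j], to stay in the box. *)
  pose h := [ffun j => if [pick l | same_group (tnth f l) (inl (j, Ordinal m_gt0))]
    is Some l then al l else h0 j].
  have same j l : same_group (tnth f l) (inl (j, Ordinal m_gt0)) ->
      exists p, tnth f l = inl (j, p).
    by case: (tnth f l) => [[j' p]|p] //= /eqP->; exists p.
  have hW j : h j \in W j.
    rewrite ffunE; case: pickP => [l /same[p fl]|_]; last exact: h0W.
    by have [] := alP l j p fl.
  have [_ _ _ EQh] := inW h hW.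
  move: fE; rewrite -EQh inE => /andP[_].
  suff -> : map_tuple (vmap g x0 h) f = e by [].
  apply: eq_from_tnth => l; rewrite tnth_map.
  case fl: (tnth f l) => [[j p]|p] /=; last first.
    by have := e_pres l; rewrite fl /= => /set1P.
  rewrite ffunE; case: pickP => [l' fl'|/(_ l)]; last by rewrite fl /= eqxx.
  have eq_f : tnth f l = tnth f l'.
    have [p' fp'] := same _ _ fl'.
    have /forallP/(_ l)/forallP/(_ l')/implyP := opf.
    by rewrite fl fp' /= eqxx => /(_ isT)/eqP.
  have [_ <-] := alP l' j p (etrans (esym eq_f) fl).
  by have /forallP/(_ l')/implyP := e_eq l; rewrite eq_f eqxx => /(_ isT)/eqP.
(* The vector identity [sum_es] is read at [u]: it gives [cn j] at a vertex of cluster [j] and 1 at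
   a vertex of [x0]. *)
have Vc_sum u : \sum_(f <- es) mult u f = #|Vc u|.
  have lhs : Posz (\sum_(f <- es) mult u f) = (\sum_(f <- es) mass f)%R u.
    by rewrite sum_ffunE -natz natr_sum; apply: eq_bigr => f _; rewrite ffunE natz.
  apply/eqP; rewrite -eqz_nat lhs sum_es ffunE ffunE sum_ffunE.
  case: u {lhs} => [[j p]|p] /=.
    rewrite big1 => [|q _]; last by rewrite ffunE.
    by rewrite addr0 card_imset ?cardW' // => a a' /g_inj[].
  rewrite add0r (bigD1 p) //= big1 => [|q qp]; rewrite ffunE.
    by rewrite eqxx addr0 cards1.
  by rewrite (inj_eq (@inr_inj _ _)) eq_sym (negPf qp).
have [M matM covM] := fissile_matching fisH Vc_V Vc_disj Vc_strict esE Vc_sum.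
exists (x0 |: \bigcup_j W' j), M; split=> //; first exact: setU11.
move=> v; rewrite -covM; split=> [[a [i [aB ->]]]|[[[j p]|p] /=]].
- case/setU1P: aB => [->|/finset.bigcupP[j _ aj]].
    by exists (inr i); rewrite /= set11.
  by exists (inl (j, i)); apply/imsetP; exists a.
- case/imsetP => a aj ->; exists a, p; split=> //.
  by rewrite !inE; apply/orP; right; apply/finset.bigcupP; exists j.
- by move/set1P ->; exists x0, p; rewrite setU11.
Qed.

(** * Frames *)

Section Frames.

Variables (m : nat) (T : finType).
Implicit Types (W : {set T}) (F : {set m.-tuple T}).
Hypothesis m_gt0 : 0 < m.

Record frame (W : {set T}) (F : {set m.-tuple T}) : Prop := Frame {
  frame_uniq : forall e, e \in F -> uniq e;
  frame_disjoint : forall e f v, e \in F -> f \in F -> v \in e -> v \in f -> e = f;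
  frame_cover : forall v, v \in W <-> exists2 e, e \in F & v \in e
}.

Lemma frame_inj W F (a b : {e : m.-tuple T | e \in F}) (i j : 'I_m) : frame W F ->
  tnth (val a) i = tnth (val b) j -> a = b /\ i = j.
Proof.
move=> [uF dF _] eq_t.
have eq_ab : a = b.
  apply/val_inj/(dF _ _ (tnth (val a) i) (valP a) (valP b)); first exact: mem_tnth.
  by have := mem_tnth j (val b); rewrite -eq_t.
split=> //; move: eq_t; rewrite -eq_ab; apply: tnth_inj; exact: uF (valP a).
Qed.

Lemma frame_coverP W F v : frame W F ->
  v \in W <-> exists (a : {e : m.-tuple T | e \in F}) i, v = tnth (val a) i.
Proof.
move=> fr; rewrite (frame_cover fr); split=> [[e eF /tnthP[i ->]]|[a [i ->]]].
  by exists (Sub e eF), i.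
by exists (val a); [exact: valP|exact: mem_tnth].
Qed.

Lemma card_frame W F : frame W F -> #|W| = #|F| * m.
Proof.
move=> fr; rewrite (@card_cover m T _ (val : {e | e \in F} -> _) W).
- by rewrite card_sig.
- by move=> a b i j; exact: frame_inj fr.
- by move=> v; exact: frame_coverP.
Qed.

Lemma frame_exists W : m %| #|W| -> exists F, frame W F.
Proof.
have [n] := ubnP #|W|; elim: n W => // n IHn W /ltnSE leW dvW.
have [W0|W_gt0] := posnP #|W|.
  exists finset.set0; split=> [e|e f v|v]; rewrite ?inE //.
  have -> : W = finset.set0 by apply/eqP; rewrite -cards_eq0 W0.
  by rewrite inE; split=> // -[e]; rewrite inE.
have le_m : m <= #|W| by exact: dvdn_leq.
have /card_geqP[t [ut st tW]] := le_m.
pose t' := [set x in t].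
have ct : #|t'| = m by rewrite cardsE (card_uniqP ut).
have t'W : t' \subset W by apply/fintype.subsetP => x; rewrite inE => /tW.
have cW' : #|W :\: t'| = #|W| - m by rewrite cardsD (finset.setIidPr t'W) ct.
have [||F [uF dF cF]] := IHn (W :\: t').
- by rewrite cW'; lia.
- by rewrite cW' dvdn_sub.
have st' : size t == m by apply/eqP.
pose e := Tuple st'.
have Fe f v : f \in F -> v \in f -> v \in e -> False.
  move=> fF vf ve; have /cF : exists2 f, f \in F & v \in f by exists f.
  by rewrite !inE ve.
exists (e |: F); split.
- by move=> f /setU1P[->|/uF].
- move=> f f' v /setU1P[->|fF] /setU1P[->|f'F] vf vf' //.
  + by case: (Fe _ _ f'F vf' vf).
  + by case: (Fe _ _ fF vf vf').
  + exact: dF vf vf'.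
move=> v; split=> [vW|[f /setU1P[->|fF] vf]].
- have [ve|ve] := boolP (v \in t'); first by exists e; [exact: setU11|rewrite inE in ve].
  have /cF[f fF vf] : v \in W :\: t' by rewrite finset.in_setD ve.
  by exists f; rewrite // setU1r.
- by apply: tW.
- have /cF : exists2 f, f \in F & v \in f by exists f.
  by case/setDP.
Qed.

(** The old groups in [B] and the new ones in [M] both partition [W'] into tuples of [m] distinct
    vertices, so their numbers agree. *)
Lemma frame_replace W F (B : {set {e : m.-tuple T | e \in F}})
    (M : {set m.-tuple T}) (W' : {set T}) :
  frame W F -> frame W' M ->
  (forall v, v \in W' <-> exists a i, a \in B /\ v = tnth (val a) i) ->
  frame W ((F :\: val @: B) :|: M) /\ #|M| = #|B|.
Proof.
move=> fr frM coverW'.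
have old_new e f v : e \in F -> e \notin val @: B -> f \in M ->
    v \in e -> v \in f -> False.
  move=> eF eB fM ve vf.
  have /coverW'[a [i [aB va]]] : v \in W' by apply/(frame_cover frM); exists f.
  move/imsetP: eB; apply; exists a => //.
  by apply: (frame_disjoint fr eF (valP a) ve); rewrite va mem_tnth.
split; last first.
  apply/eqP; rewrite -(eqn_pmul2r m_gt0) -(card_frame frM).
  rewrite -(card_imset _ val_inj); apply/eqP/card_frame; split.
  - by move=> _ /imsetP[a _ ->]; apply: (frame_uniq fr); exact: valP.
  - move=> _ _ v /imsetP[a _ ->] /imsetP[b _ ->].
    by apply: (frame_disjoint fr); exact: valP.
  - move=> v; rewrite coverW'; split=> [[a [i [aB ->]]]|[_ /imsetP[a aB ->] /tnthP[i ->]]].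
      by exists (val a); [exact: imset_f|exact: mem_tnth].
    by exists a, i.
split.
- by move=> e /setUP[/setDP[/(frame_uniq fr)]|/(frame_uniq frM)].
- move=> e f v /setUP[/setDP[eF eB]|eM] /setUP[/setDP[fF fB]|fM] ve vf.
  + exact: (frame_disjoint fr eF fF ve vf).
  + by case: (old_new e f v).
  + by case: (old_new f e v).
  + exact: (frame_disjoint frM eM fM ve vf).
move=> v; rewrite (frame_cover fr); split=> [[e eF ve]|[e /setUP[/setDP[eF _]|eM] ve]].
- have [/imsetP[a aB ea]|eB] := boolP (e \in val @: B); last first.
    by exists e; rewrite // !inE eB eF.
  have /(frame_cover frM)[f fM vf] : v \in W'.
    apply/coverW'; move: ve; rewrite ea => /tnthP[i ->]; by exists a, i.
  by exists f; rewrite // inE fM orbT.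
- by exists e.
- have /coverW'[a [i [_ ->]]] : v \in W' by apply/(frame_cover frM); exists e.
  by exists (val a); [exact: valP|exact: mem_tnth].
Qed.

End Frames.

(** * A frame with the most edges *)

Theorem theorem2p8 (R : realType) (m s : nat) (hm : 2 <= m) (hms : m <= s) :
  exists n0 : nat, s <= n0 /\
    forall (T : finType) (H : digraph m T),
      n0 <= #|verts H| ->
      m %| #|verts H| ->
      fissile H ->
      robustly_satisfies s H (Spa R `&` Div `&` Cov)%classic ->
      exists M : {set m.-tuple T}, perfect_matching H M.
Proof.
have m_gt0 : 0 < m by exact: ltnW.
case: s hms => [|k] hms; first by rewrite leqNgt m_gt0 in hms.
have [N0 augment] := @augmentation R m k hm hms.
(* The summand [N0 * m] provides [N0] groups in every frame, and [k.+1] makes the bound at least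
   [s]. *)
exists (k.+1 + N0 * m); split; first exact: leq_addr.
move=> T H leH dvH fisH rob.
have [F0 fr0] := frame_exists m_gt0 dvH.
have [F /asboolP fr max_F] := @arg_maxnP _ F0 (fun F => `[< frame (verts H) F >])
  (fun F => #|F :&: edges H|) (asboolT fr0).
have leF : N0 <= #|F|.
  by rewrite -(leq_pmul2r m_gt0) -(card_frame fr) (leq_trans (leq_addl _ _) leH).
have [FH|] := boolP (F \subset edges H).
  exists F; split; last by move=> v /(frame_cover fr).
  by split=> //; [exact: frame_uniq fr|exact: frame_disjoint fr].
case/subsetPn => x xF xH.
pose A := {e : m.-tuple T | e \in F}; pose x0 : A := Sub x xF.
have [|B [M [x0B [MH uM dM] covM]]] :=
  augment T A val H (fun a b i j => @frame_inj m T _ F a b i j fr)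
    (fun v => frame_coverP v fr) fisH rob _ x0; first by rewrite card_sig.
pose W' := [set v | [exists a in B, v \in val a]].
have covW' v : v \in W' <-> exists a i, a \in B /\ v = tnth (val a) i.
  rewrite inE; split=> [/exists_inP[a aB /tnthP[i ->]]|[a [i [aB ->]]]].
    by exists a, i.
  by apply/exists_inP; exists a => //; exact: mem_tnth.
have frM : frame W' M by split=> // v; rewrite covW' covM.
have [fr' cardM] := frame_replace m_gt0 fr frM covW'.
have /= := max_F _ (asboolT fr'); rewrite leqNgt => /negP; case.
set F1 := F :\: val @: B.
(* The edges of [M] are new, so all of them count in addition to the edges kept in [F1]. *)
have disj : [disjoint F1 :&: edges H & M].
  apply/pred0Pn => -[e /= /andP[/setIP[/setDP[eF eB] _] eM]].
  have et := mem_tnth (Ordinal m_gt0) e.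
  have /covM[a [i [aB eq_t]]] : exists2 f, f \in M & tnth e (Ordinal m_gt0) \in f.
    by exists e.
  move/imsetP: eB; apply; exists a => //.
  by apply: (frame_disjoint fr eF (valP a) et); rewrite eq_t mem_tnth.
have -> : (F1 :|: M) :&: edges H = (F1 :&: edges H) :|: M.
  by rewrite finset.setIUl (finset.setIidPl MH).
rewrite cardsU (eqP (_ : F1 :&: edges H :&: M == finset.set0)) ?setI_eq0 //.
rewrite cards0 subn0 cardM (cardsD1 x0 B) x0B addnA addn1 addSn ltnS.
(* The edges lost are among the groups of [B] other than [x0], at most [#|B| - 1] of them, against
   [#|B|] edges gained from [M]. *)
have sub : F :&: edges H \subset (F1 :&: edges H) :|: val @: (B :\ x0).
  apply/fintype.subsetP => e /setIP[eF eH].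
  have [/imsetP[a aB ea]|eB] := boolP (e \in val @: B); last first.
    by rewrite !inE eF eH eB.
  apply/setUP; right; apply/imsetP; exists a => //; rewrite !inE aB andbT.
  by apply: contraNneq xH => ax; rewrite -[x]/(val x0) -ax -ea.
apply: leq_trans (subset_leq_card sub) _.
by rewrite (leq_trans (leq_card_setU _ _)) // leq_add2l leq_imset_card.
Qed.
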